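(* Let $\Omega \subset \mathbb R^d$ be a nonempty, open, bounded, connected set whose boundary $\partial\Omega$ is a compact $\mathbf C^{1,1}$ submanifold of $\mathbb R^d$ of dimension $d-1$, let $\Gamma \subset \bar\Omega$ be nonempty and closed, and let $k: \mathbb R_+ \times \bar\Omega \to \mathbb R_+$ be continuous with values in $[K_{\min}, K_{\max}]$ for some positive constants $K_{\min}, K_{\max}$ and such that $|k(t,x_1) - k(t,x_2)| \le L|x_1 - x_2|$ for all $t \in \mathbb R_+$, $x_1, x_2 \in \bar\Omega$, for some $L > 0$. Consider the optimal control problem $\mathrm{OCP}(k)$, with value function $\varphi$, and the penalized problems $\mathrm{OCP}_\epsilon(k_\epsilon)$, with value functions $\varphi_\epsilon$. There exists $\epsilon_0 > 0$ such that, for every $\epsilon \in (0, \epsilon_0)$ and $(t_0, x_0) \in \mathbb R_+ \times \bar\Omega$, we have $\mathrm{Opt}_\epsilon(k_\epsilon, t_0, x_0) = \mathrm{Opt}(k, t_0, x_0)$ and $\varphi_\epsilon(t_0, x_0) = \varphi(t_0, x_0)$.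
   Context: $\mathbb R_+ = [0,\infty)$, $\bar B$ is the closed unit ball of $\mathbb R^d$, $d_\Omega(x) = \inf_{y \in \Omega} |x-y|$, $a_+ = \max(0,a)$. For a Lipschitz curve $\gamma$ and $t_0 \ge 0$, $\tau(t_0, \gamma) = \inf\{t \ge 0 : \gamma(t + t_0) \in \Gamma\}$ ($+\infty$ if there is no such $t$). Problem $\mathrm{OCP}(k)$ (state constrained): $\mathrm{Adm}(k)$ is the set of Lipschitz continuous $\gamma: \mathbb R_+ \to \bar\Omega$ for which there is a measurable $u: \mathbb R_+ \to \bar B$ (the control) with $\dot\gamma(t) = k(t, \gamma(t)) u(t)$ for a.e. $t \ge 0$. The value function is $\varphi(t_0, x_0) = \inf\{\tau(t_0, \gamma) : \gamma \in \mathrm{Adm}(k),\ \gamma(t_0) = x_0\}$. $\mathrm{Opt}(k, t_0, x_0)$ is the set of $\gamma \in \mathrm{Adm}(k)$ such that $\gamma(t) = x_0$ for $t \in [0, t_0]$, $\tau(t_0, \gamma) = \varphi(t_0, x_0)$, and $\gamma(t) = \gamma(t_0 + \tau(t_0, \gamma))$ for all $t \ge t_0 + \tau(t_0, \gamma)$. Penalized problem: fix an extension of $k$, still denoted $k$, to a continuous function $\mathbb R_+ \times \mathbb R^d \to [K_{\min}, K_{\max}]$ such that $x \mapsto k(t,x)$ is $L$-Lipschitz on $\mathbb R^d$ for every $t$. For $\epsilon > 0$ let $k_\epsilon(t,x) = k(t,x)\left(1 - \frac1\epsilon d_\Omega(x)\right)_+$ on $\mathbb R_+ \times \mathbb R^d$.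 $\mathrm{Adm}_\epsilon(k_\epsilon)$ is the set of Lipschitz continuous $\gamma: \mathbb R_+ \to \mathbb R^d$ for which there is a measurable $u: \mathbb R_+ \to \bar B$ with $\dot\gamma(t) = k_\epsilon(t, \gamma(t)) u(t)$ for a.e. $t \ge 0$ (no state constraint). $\varphi_\epsilon(t_0, x_0) = \inf\{\tau(t_0, \gamma): \gamma \in \mathrm{Adm}_\epsilon(k_\epsilon),\ \gamma(t_0) = x_0\} \in [0, +\infty]$ for $(t_0,x_0) \in \mathbb R_+ \times \mathbb R^d$. $\mathrm{Opt}_\epsilon(k_\epsilon, t_0, x_0)$ is the set of $\gamma \in \mathrm{Adm}_\epsilon(k_\epsilon)$ such that $\gamma(t) = x_0$ on $[0,t_0]$, $\tau(t_0,\gamma) = \varphi_\epsilon(t_0,x_0) < +\infty$, and $\gamma(t) = \gamma(t_0 + \tau(t_0,\gamma))$ for all $t \ge t_0 + \tau(t_0,\gamma)$. Curves with values in $\bar\Omega$ are regarded as curves in $\mathbb R^d$. *)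

(* Defs.v *)
From HB Require Import structures.
From mathcomp Require Import all_boot all_order all_algebra.
From mathcomp Require Import all_classical all_reals all_analysis.

Set Implicit Arguments.
Unset Strict Implicit.
Unset Printing Implicit Defensive.

Import Order.TTheory GRing.Theory Num.Theory.
Import numFieldNormedType.Exports.

Local Open Scope classical_set_scope.
Local Open Scope ring_scope.

(* The library norm `|x| on 'rV[R]_d is the sup norm. The Euclidean norm below
   is used wherever the constants matter; the topology, differentiability and
   being Lipschitz for some constant do not depend on this choice. *)
Definition enorm (R : realType) (d : nat) (x : 'rV[R]_d) : R :=
  Num.sqrt (\sum_(i < d) x ord0 i ^+ 2).

Definition edist (R : realType) (d : nat) (A : set 'rV[R]_d) (x : 'rV[R]_d) : R :=
  inf [set enorm (x - y) | y in A].

Definition bdry (T : topologicalType) (A : set T) : set T :=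
  closure A `\` interior A.

Definition C11_on (R : realType) (n m : nat) (U : set 'rV[R]_n)
    (f : 'rV[R]_n -> 'rV[R]_m) : Prop :=
  (forall x, U x -> differentiable f x) /\
  (forall x, U x -> exists2 N, nbhs x N & [lipschitz jacobian f y | y in N]).

Definition C11_diffeo (R : realType) (n : nat) (U V : set 'rV[R]_n)
    (psi : 'rV[R]_n -> 'rV[R]_n) : Prop :=
  set_fun U V psi /\ C11_on U psi /\
  exists2 chi : 'rV[R]_n -> 'rV[R]_n, set_fun V U chi /\ C11_on V chi &
    {in U, cancel psi chi} /\ {in V, cancel chi psi}.

(* R^m x {0} inside R^n *)
Definition flat (R : realType) (n m : nat) : set 'rV[R]_n :=
  [set y | forall i : 'I_n, (m <= i)%N -> y ord0 i = 0].
Arguments flat : clear implicits.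

Definition C11_submanifold (R : realType) (n m : nat) (M : set 'rV[R]_n) : Prop :=
  forall p, M p -> exists U V : set 'rV[R]_n, exists psi : 'rV[R]_n -> 'rV[R]_n,
    [/\ open U, U p, open V, C11_diffeo U V psi &
        psi @` (M `&` U) = flat R n m `&` V].

(* Curves R_+ -> R^d and controls R_+ -> R^d are represented by total functions
   on R; only their values at nonnegative times are ever constrained. *)

Definition hitting_time (R : realType) (d : nat) (Gam : set 'rV[R]_d)
    (t0 : R) (g : R -> 'rV[R]_d) : \bar R :=
  ereal_inf [set t%:E | t in [set t : R | 0 <= t /\ Gam (g (t + t0))]].

(* Admissible curves for the dynamics k under the state constraint g(t) \in X.
   Borel measurability of the control is no restriction: a Lebesgue measurable
   control agrees a.e. with a Borel one, and the equation is only required a.e. *)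
Definition Adm (R : realType) (d : nat) (X : set 'rV[R]_d)
    (k : R -> 'rV[R]_d -> R) : set (R -> 'rV[R]_d) :=
  [set g | [/\ [lipschitz g t | t in [set t : R | 0 <= t]],
      (forall t, 0 <= t -> X (g t)) &
      exists u : R -> 'rV[R]_d,
        [/\ (forall i, measurable_fun [set t : R | 0 <= t] (fun t => u t ord0 i)),
            (forall t, 0 <= t -> enorm (u t) <= 1) &
            {ae lebesgue_measure, forall t : R, 0 <= t ->
               is_derive t (1 : R) g (k t (g t) *: u t)}]]].

Definition value (R : realType) (d : nat) (X : set 'rV[R]_d)
    (k : R -> 'rV[R]_d -> R) (Gam : set 'rV[R]_d) (t0 : R) (x0 : 'rV[R]_d) : \bar R :=
  ereal_inf [set hitting_time Gam t0 g | g in [set g | Adm X k g /\ g t0 = x0]].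

Definition optimal (R : realType) (d : nat) (X : set 'rV[R]_d)
    (k : R -> 'rV[R]_d -> R) (Gam : set 'rV[R]_d) (t0 : R) (x0 : 'rV[R]_d) :
    set (R -> 'rV[R]_d) :=
  [set g | [/\ Adm X k g,
      (forall t, 0 <= t <= t0 -> g t = x0),
      hitting_time Gam t0 g = value X k Gam t0 x0 &
      forall t : R, (t0%:E + hitting_time Gam t0 g <= t%:E)%E ->
        g t = g (t0 + fine (hitting_time Gam t0 g))]].

Definition OCP_value (R : realType) (d : nat) (Omega Gam : set 'rV[R]_d)
    (k : R -> 'rV[R]_d -> R) (t0 : R) (x0 : 'rV[R]_d) : \bar R :=
  value (closure Omega) k Gam t0 x0.

Definition Opt (R : realType) (d : nat) (Omega Gam : set 'rV[R]_d)
    (k : R -> 'rV[R]_d -> R) (t0 : R) (x0 : 'rV[R]_d) : set (R -> 'rV[R]_d) :=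
  optimal (closure Omega) k Gam t0 x0.

Definition kpen (R : realType) (d : nat) (Omega : set 'rV[R]_d) (eps : R)
    (k : R -> 'rV[R]_d -> R) (t : R) (x : 'rV[R]_d) : R :=
  k t x * Num.max 0 (1 - eps^-1 * edist Omega x).

Definition OCP_value_eps (R : realType) (d : nat) (Gam : set 'rV[R]_d)
    (keps : R -> 'rV[R]_d -> R) (t0 : R) (x0 : 'rV[R]_d) : \bar R :=
  value setT keps Gam t0 x0.

Definition Opt_eps (R : realType) (d : nat) (Gam : set 'rV[R]_d)
    (keps : R -> 'rV[R]_d -> R) (t0 : R) (x0 : 'rV[R]_d) : set (R -> 'rV[R]_d) :=
  optimal setT keps Gam t0 x0 `&`
  [set g | (OCP_value_eps Gam keps t0 x0 < +oo)%E].

(* The standing assumption on the speed k over R_+ x X. *)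
Definition speed_on (R : realType) (d : nat) (X : set 'rV[R]_d)
    (Kmin Kmax L : R) (k : R -> 'rV[R]_d -> R) : Prop :=
  [/\ {within [set p : R * 'rV[R]_d | 0 <= p.1 /\ X p.2],
         continuous (fun p : R * 'rV[R]_d => k p.1 p.2)},
      (forall t x, 0 <= t -> X x -> Kmin <= k t x <= Kmax) &
      (forall t x1 x2, 0 <= t -> X x1 -> X x2 ->
         `|k t x1 - k t x2| <= L * enorm (x1 - x2))].

(* Main.v *)
Require Import Defs.
From HB Require Import structures.
From mathcomp Require Import all_boot all_order all_algebra.
From mathcomp Require Import ring lra.
From mathcomp Require Import all_classical all_reals all_analysis.
From mathcomp Require Import measurable_realfun.

Set Implicit Arguments.
Unset Strict Implicit.
Unset Printing Implicit Defensive.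

Import Order.TTheory GRing.Theory Num.Theory.
Import numFieldNormedType.Exports.

Local Open Scope classical_set_scope.
Local Open Scope ring_scope.

(** The idea is to project a penalized curve onto the closure A of the domain.

    Because the boundary is C^{1,1}, A is proximally regular: if a is a point of
    A nearest to x, then dot (x - a) (b - a) <= C |x - a| |b - a|^2 for all b in
    A ([proximal_uniform]). Hence the nearest point map P has, near a point at
    distance D from A, a Lipschitz constant of at most 1 / (1 - 2 C D)
    ([nearest_lipschitz]). Let g be a penalized curve that starts in A; its
    distance D to A never exceeds eps ([penalized_stays_close]). Projecting g
    multiplies its speed by 1 + O(D), and the speed allowed at P (g t) differs
    from the one at g t by O(D), while the penalty has multiplied the allowed
    speed by 1 - D / eps. For eps small the penalty wins, with a margin:
    P \o g is admissible for the constrained problem and even slower than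
    allowed by a factor 1 - D ([projected_speed]). It arrives at the target
    when g does, the target being in A. Therefore both values are equal.

    If g leaves A before it arrives, then D > 0 during some time interval, and
    the projection is strictly slower than allowed there. This slack can be
    turned into an earlier arrival ([faster_curve]), so a curve that is optimal
    for the penalized problem stays in A and is optimal for the constrained one.
    Conversely constrained curves are penalized curves, and the constrained
    value is finite because A is connected by Lipschitz paths
    ([joined_value_finite]).

    Proximal regularity only uses that any two neighbouring points a and b of A
    are joined by a path in A with an initial velocity w such that
    |b - a - w| <= C |b - a|^2 ([tangent_path]). In a chart that flattens the
    boundary, A becomes convex ([chart_convex]), and the images of segments are
    such paths. At a nearest point a of x the velocity w makes a nonpositive
    product with x - a, which gives the inequality.

    All constructions of curves are made in terms of pointwise bounds on the
    speed ([speed_at_most]). That admissible curves are exactly the curves with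
    such a bound takes, in one direction, the mean value inequality for
    Lipschitz functions with an almost everywhere bounded derivative
    ([ae_derive_increment], [Adm_speed]) and, in the other, the differentiability
    almost everywhere of Lipschitz functions ([lipschitz_ae_derivable],
    [speed_Adm]). *)


(** * Euclidean geometry of row vectors *)

Section Euclid.
Variables (R : realType) (d : nat).
Implicit Types (x y z : 'rV[R]_d) (a : R).

Definition dot x y : R := \sum_(i < d) x ord0 i * y ord0 i.

Lemma dotC x y : dot x y = dot y x.
Proof. by apply: eq_bigr => i _; rewrite mulrC. Qed.

Lemma dotDl x y z : dot (x + y) z = dot x z + dot y z.
Proof. by rewrite -big_split; apply: eq_bigr => i _; rewrite mxE mulrDl. Qed.

Lemma dotZl a x y : dot (a *: x) y = a * dot x y.
Proof. by rewrite mulr_sumr; apply: eq_bigr => i _; rewrite mxE mulrA. Qed.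

Lemma dotNl x y : dot (- x) y = - dot x y.
Proof. by rewrite -scaleN1r dotZl mulN1r. Qed.

Lemma dotBl x y z : dot (x - y) z = dot x z - dot y z.
Proof. by rewrite dotDl dotNl. Qed.

Lemma dotDr x y z : dot x (y + z) = dot x y + dot x z.
Proof. by rewrite !(dotC x) dotDl. Qed.

Lemma dotZr a x y : dot x (a *: y) = a * dot x y.
Proof. by rewrite !(dotC x) dotZl. Qed.

Lemma dotNr x y : dot x (- y) = - dot x y.
Proof. by rewrite !(dotC x) dotNl. Qed.

Lemma dotBr x y z : dot x (y - z) = dot x y - dot x z.
Proof. by rewrite dotDr dotNr. Qed.

Lemma dot_ge0 x : 0 <= dot x x.
Proof. by apply: sumr_ge0 => i _; rewrite -expr2 sqr_ge0. Qed.

Lemma enorm_ge0 x : 0 <= enorm x.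
Proof. exact: sqrtr_ge0. Qed.

Lemma enormE x : enorm x ^+ 2 = dot x x.
Proof.
rewrite /enorm sqr_sqrtr; first by apply: eq_bigr => i _; rewrite expr2.
by apply: sumr_ge0 => i _; rewrite sqr_ge0.
Qed.

Lemma enorm_def x : enorm x = Num.sqrt (dot x x).
Proof. by rewrite -enormE sqrtr_sqr ger0_norm ?enorm_ge0. Qed.

Lemma enormZ a x : enorm (a *: x) = `|a| * enorm x.
Proof. by rewrite !enorm_def dotZl dotZr mulrA -expr2 sqrtrM ?sqr_ge0// sqrtr_sqr. Qed.

Lemma enormN x : enorm (- x) = enorm x.
Proof. by rewrite -scaleN1r enormZ normrN1 mul1r. Qed.

Lemma enorm_distC x y : enorm (x - y) = enorm (y - x).
Proof. by rewrite -enormN opprB. Qed.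

Lemma enorm0 : enorm (0 : 'rV[R]_d) = 0.
Proof. by rewrite -(scale0r 0) enormZ normr0 mul0r. Qed.

Lemma coord_le_enorm x i : `|x ord0 i| <= enorm x.
Proof.
rewrite -(@ler_pXn2r _ 2)// ?nnegrE ?enorm_ge0// enormE real_normK ?num_real//.
rewrite /dot (bigD1 i)//= -expr2 lerDl.
by apply: sumr_ge0 => j _; rewrite -expr2 sqr_ge0.
Qed.

Lemma enorm_eq0 x : enorm x = 0 -> x = 0.
Proof.
move=> x0; apply/rowP => i; rewrite mxE; apply/eqP; rewrite -normr_le0 -x0.
exact: coord_le_enorm.
Qed.


Lemma cauchy_schwarz x y : dot x y <= enorm x * enorm y.
Proof.
have dot0 z : dot 0 z = 0 by rewrite -(scale0r 0) dotZl mul0r.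
have [/enorm_eq0 ->|x0] := eqVneq (enorm x) 0.
  by rewrite dot0 enorm0 mul0r.
have [/enorm_eq0 ->|y0] := eqVneq (enorm y) 0.
  by rewrite dotC dot0 enorm0 mulr0.
have xy : 0 < enorm x * enorm y by rewrite mulr_gt0// lt0r ?x0 ?y0 enorm_ge0.
have := dot_ge0 (enorm y *: x - enorm x *: y).
rewrite dotBl !dotBr !dotZl !dotZr (dotC y x) -!enormE => h.
rewrite -(ler_pM2l xy) -subr_ge0.
by rewrite (_ : _ - _ = 2^-1 * (enorm y * (enorm y * enorm x ^+ 2) -
  enorm y * (enorm x * dot x y) - (enorm x * (enorm y * dot x y) -
   enorm x * (enorm x * enorm y ^+ 2)))) ?mulr_ge0//; field.
Qed.

Lemma enormD x y : enorm (x + y) <= enorm x + enorm y.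
Proof.
rewrite -(@ler_pXn2r _ 2)// ?nnegrE ?addr_ge0 ?enorm_ge0//.
rewrite enormE dotDl !dotDr (dotC y x) -!enormE.
have := cauchy_schwarz x y; lra.
Qed.

Lemma enorm_tri x y z : enorm (x - z) <= enorm (x - y) + enorm (y - z).
Proof. by rewrite -[x - z](subrKA y) enormD. Qed.

Lemma enormB x y : `|enorm x - enorm y| <= enorm (x - y).
Proof.
have h (u v : 'rV[R]_d) : enorm u - enorm v <= enorm (u - v).
  by rewrite lerBlDr; have := enormD (u - v) v; rewrite subrK.
rewrite ler_norml h andbT lerNl opprB enorm_distC; exact: h.
Qed.

Lemma norm_le_enorm x : `|x| <= enorm x.
Proof.
rewrite [`|x|]mx_normrE; apply/bigmax_leP; split; first exact: enorm_ge0.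
by move=> [i j] _ /=; rewrite ord1 coord_le_enorm.
Qed.

Lemma enorm_le_norm x : enorm x <= d%:R * `|x|.
Proof.
have xi i : `|x ord0 i| <= `|x|.
  rewrite [in leRHS]/Num.Def.normr/= mx_normrE.
  exact: (le_bigmax _ (fun k : 'I_1 * 'I_d => `|x k.1 k.2|) (ord0, i)).
rewrite -(@ler_pXn2r _ 2)// ?nnegrE ?mulr_ge0 ?enorm_ge0//.
rewrite enormE /dot; apply: (@le_trans _ _ (\sum_(i < d) `|x| ^+ 2)).
  apply: ler_sum => i _; rewrite -expr2 -[leLHS]real_normK ?num_real//.
  by rewrite ler_pXn2r ?nnegrE.
rewrite sumr_const card_ord exprMn -[leLHS]mulr_natl ler_wpM2r ?sqr_ge0//.
by rewrite -natrX ler_nat expnS expn1; case: (d) => // n; rewrite leq_pmulr.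
Qed.

Lemma enorm_continuous : continuous (@enorm R d).
Proof.
move=> x; apply/(@cvgrPdist_lt _ _ _ (nbhs x)) => e e0 /=.
have e'0 : 0 < e / d.+1%:R by rewrite divr_gt0.
apply: filterS (nbhsx_ballx x _ e'0) => y; rewrite -ball_normE /= => xy.
apply: le_lt_trans (enormB _ _) _.
apply: le_lt_trans (enorm_le_norm _) _.
apply: (@le_lt_trans _ _ (d.+1%:R * `|x - y|)).
  by rewrite ler_wpM2r// ler_nat.
by rewrite mulrC -ltr_pdivlMr.
Qed.

Lemma enorm_nbhs x (e : R) : 0 < e -> \forall y \near x, enorm (y - x) < e.
Proof.
move=> e0; have := @enorm_continuous 0; rewrite /continuous_at enorm0.
move=> /(@cvgrPdist_lt _ _ _ (nbhs _))/(_ e e0) h.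
have h' : \forall z \near (0 : 'rV[R]_d), enorm z < e.
  by apply: filterS h => z /=; rewrite sub0r normrN ger0_norm ?enorm_ge0.
have [r /= r0 rP] := (@nbhs_ballP _ _ (0 : 'rV[R]_d) _).1 h'.
apply: filterS (nbhsx_ballx x _ r0) => y; rewrite -ball_normE /= => xy.
by apply: rP; rewrite -ball_normE /= sub0r normrN distrC.
Qed.

End Euclid.

(** * Curves with a pointwise bound on their speed *)

Section OneVariable.
Variable R : realType.
Implicit Types (a b t s e : R).

(** Real induction: the supremum of the times up to which f stays below f a is
    reached, by the lower semicontinuity from the left, and would be exceeded if
    it were not b. *)
Lemma right_nonincreasing (f : R -> R) a b : a <= b ->
  (forall t e, a < t <= b -> 0 < e -> exists2 r, 0 < r &
     forall s, a <= s -> t - r < s -> s <= t -> f t <= f s + e) ->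
  (forall t, a <= t < b -> exists2 r, 0 < r &
     forall s, t < s -> s < t + r -> f s <= f t) ->
  f b <= f a.
Proof.
move=> ab fc fr.
pose S := [set t | a <= t <= b /\ forall s, a <= s <= t -> f s <= f a].
have Sa : S a by split=> [|s /le_anti ->//]; rewrite lexx.
have Sub : ubound S b by move=> t [/andP[]].
have hS : has_sup S by split; [exists a|exists b].
set t := sup S.
have at_ : a <= t by exact: ub_le_sup (ex_intro _ b Sub) _ Sa.
have tb : t <= b by apply: ge_sup => //; exists a.
have lt_t s : a <= s -> s < t -> f s <= f a.
  move=> as_ st; have st0 : 0 < t - s by rewrite subr_gt0.
  have [u [_ Su]] := sup_adherent st0 hS.
  by rewrite opprB addrCA subrr addr0 => su; apply: Su; rewrite as_ ltW.
have ft : f t <= f a.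
  rewrite leNgt; apply/negP => fat.
  have atlt : a < t by rewrite lt_neqAle at_ andbT; apply: contraTneq fat => ->; rewrite ltxx.
  have e0 : 0 < (f t - f a) / 2 by lra.
  have [|r r0 rP] := fc t _ _ e0; first by rewrite atlt.
  pose s := Num.max a (t - r / 2).
  have st : s < t by rewrite gt_max atlt/=; lra.
  have := lt_t s; rewrite le_max lexx => /(_ erefl st).
  have rs : t - r / 2 <= s by rewrite le_max lexx orbT.
  have := rP s; rewrite le_max lexx => /(_ erefl).
  move=> /(_ ltac:(lra) (ltW st)); lra.
have St : S t.
  split; first by rewrite at_.
  move=> s /andP[as_]; rewrite le_eqVlt => /predU1P[->//|]; exact: lt_t.
have [//|ltb] := leP b t => [bt|].
  by rewrite (_ : b = t) //; apply/le_anti; rewrite bt.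
have [|r r0 rP] := fr t; first by rewrite at_.
pose u := Num.min b (t + r / 2).
have tu : t < u by rewrite lt_min ltb/=; lra.
have ur : u < t + r by rewrite gt_min; apply/orP; right; lra.
suff : S u by move/(ub_le_sup (ex_intro _ b Sub)); rewrite leNgt tu.
split; first by rewrite (le_trans at_ (ltW tu)) ge_min lexx.
move=> s /andP[as_ su]; have [st|ts] := leP s t.
  by have [_] := St; apply; rewrite as_.
by apply: le_trans ft; apply: rP => //; exact: le_lt_trans ur.
Qed.

Lemma is_derive_approx (V : normedModType R) (f : R -> V) t (D : V) :
  is_derive t (1 : R) f D -> forall e, 0 < e -> exists2 r, 0 < r &
  forall s, `|s - t| < r -> `|f s - f t - (s - t) *: D| <= e * `|s - t|.
Proof.
case=> df Df e e0; move: df; rewrite /derivable => /cvgrPdist_le/(_ _ e0).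
rewrite -/(derive f t 1) Df => /nbhs_ballP[r /= r0 rP].
exists r => // s; have [->|st] := eqVneq s t.
  by rewrite !subrr scale0r subr0 !normr0 mulr0.
move=> sr; have st0 : s - t != 0 by rewrite subr_eq0.
have := rP (s - t); rewrite /ball/= sub0r normrN => /(_ sr st0).
rewrite -[X in f X](_ : s = (s - t) *: (1 : R) + t); last first.
  by rewrite /GRing.scale /= mulr1 subrK.
rewrite -(ler_pM2r (_ : 0 < `|s - t|)) ?normr_gt0//.
by rewrite mulrC -normrZ scalerBr scalerA divff// scale1r distrC.
Qed.

Variable d : nat.
Implicit Types (g : R -> 'rV[R]_d).

(** The speed is measured by difference quotients whose two endpoints both tend
    to t. Unlike a bound on the derivative, this makes sense at every time, is
    inherited by the image under a map that is Lipschitz near the curve, and,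
    when c depends continuously on t and g is Lipschitz, is equivalent to a bound
    on the derivative at almost every time. *)
Definition speed_at_most g t (c : R) : Prop :=
  forall e, 0 < e -> exists2 r, 0 < r & forall s s', `|s - t| < r ->
    `|s' - t| < r -> enorm (g s - g s') <= (c + e) * `|s - s'|.

Lemma speed_at_most_continuous g t c : speed_at_most g t c ->
  forall e, 0 < e -> exists2 r, 0 < r &
    forall s, `|s - t| < r -> enorm (g s - g t) < e.
Proof.
move=> gt e e0; have [r r0 rP] := gt 1 ltr01.
exists (Num.min r (e / (`|c| + 2))) => [|s].
  by rewrite lt_min r0/= divr_gt0//; have := normr_ge0 c; lra.
rewrite lt_min => /andP[sr se].
apply: le_lt_trans (rP _ _ sr _) _; first by rewrite subrr normr0.
move: se; rewrite ltr_pdivlMr; last by have := normr_ge0 c; lra.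
apply: le_lt_trans; rewrite mulrC ler_wpM2l//; have := ler_norm c; lra.
Qed.

Lemma speed_at_mostW g t c c' : c <= c' -> speed_at_most g t c ->
  speed_at_most g t c'.
Proof.
move=> cc gt e e0; have [r r0 rP] := gt e e0; exists r => // s s' sr s'r.
by apply: le_trans (rP _ _ sr s'r) _; rewrite ler_wpM2r// lerD2r.
Qed.

(** The distance from g a cannot overtake sigma t + e' t to the right of any
    time t, whence the comparison as e' tends to 0. *)
Lemma speed_at_most_increment g (sigma K : R -> R) a b : a <= b ->
  (forall t, a <= t <= b -> is_derive t (1 : R) sigma (K t)) ->
  (forall t, a <= t <= b -> speed_at_most g t (K t)) ->
  enorm (g b - g a) <= sigma b - sigma a.
Proof.
move=> ab ds lg; apply/ler_addgt0Pr => e e0.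
pose e' := e / (b - a + 1).
have e'0 : 0 < e' by rewrite divr_gt0//; lra.
pose f t := enorm (g t - g a) - sigma t - e' * t.
suff : f b <= f a.
  rewrite /f subrr enorm0 sub0r => h.
  have : e' * (b - a) <= e.
    rewrite /e' mulrAC ler_pdivrMr; last by lra.
    by rewrite ler_wpM2l//; lra.
  rewrite mulrBr; lra.
apply: right_nonincreasing => // t.
- move=> e1 /andP[at_ tb] e10; have tab : a <= t <= b by rewrite ltW.
  have e20 : 0 < e1 / 4 by lra.
  have [r r0 rP] := speed_at_most_continuous (lg _ tab) e20.
  have [r' r'0 r'P] := is_derive_approx (ds _ tab) ltr01.
  pose q := e1 / (4 * (e' + `|K t| + 1)).
  have q0 : 0 < q by rewrite divr_gt0// mulr_gt0//; have := normr_ge0 (K t); lra.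
  exists (Num.min r (Num.min r' q)) => [|s as_ ts st]; first by rewrite !lt_min r0 r'0.
  have : `|s - t| < Num.min r (Num.min r' q).
    by rewrite distrC ger0_norm ?subr_ge0//; lra.
  rewrite !lt_min => /and3P[/rP h1 /r'P h2 h3].
  have := enorm_tri (g t) (g s) (g a); rewrite (enorm_distC (g t) (g s)).
  move: h2; rewrite ler_norml => /andP[_].
  move: h3; rewrite distrC ger0_norm ?subr_ge0// /q.
  rewrite ltr_pdivlMr; last by have := normr_ge0 (K t); lra.
  have De : 0 <= (t - s) * e' by rewrite mulr_ge0 ?subr_ge0// ltW.
  have : 0 <= (t - s) * (`|K t| + K t).
    by rewrite mulr_ge0 ?subr_ge0// -lerBlDr sub0r -normrN ler_norm.
  rewrite /f /GRing.scale/=; move: De; rewrite !mulrDr mulrDl; nra.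
move=> /andP[at_ tb].
have tab : a <= t <= b by rewrite at_ ltW.
have e20 : 0 < e' / 2 by lra.
have [r r0 rP] := lg _ tab _ e20.
have [r' r'0 r'P] := is_derive_approx (ds _ tab) e20.
exists (Num.min r r'); first by rewrite lt_min r0.
move=> s ts sr; have st : `|s - t| < Num.min r r'.
  by rewrite gtr0_norm ?subr_gt0//; lra.
move: st; rewrite lt_min => /andP[str str'].
have h1 := enorm_tri (g s) (g t) (g a).
have := rP s t str; rewrite subrr normr0 => /(_ r0) h2.
have := r'P s str'; rewrite ler_norml => /andP[+ _].
move: h1 h2; rewrite /f gtr0_norm ?subr_gt0//.
rewrite /GRing.scale/=; nra.
Qed.

Lemma speed_at_most_lipschitz g c a b : a <= b ->
  (forall t, a <= t <= b -> speed_at_most g t c) ->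
  enorm (g b - g a) <= c * (b - a).
Proof.
move=> ab lg; rewrite mulrBr.
apply: (@speed_at_most_increment g (fun t => c * t) (fun=> c)) => // t _.
by apply: is_derive_eq; rewrite /GRing.scale /= mulr1.
Qed.

End OneVariable.

(** * Lipschitz functions of one variable *)

Section Lipschitz.
Variable R : realType.
Let mu : {measure set (measurableTypeR R) -> \bar R} := @lebesgue_measure R.

Lemma lipschitz_continuous (f : R -> R) K :
  (forall s t, `|f s - f t| <= K * `|s - t|) -> continuous f.
Proof.
move=> fK t; apply/cvgrPdist_lt => e e0.
have e'0 : 0 < e / (`|K| + 1) by rewrite divr_gt0// ltr_wpDl.
apply: filterS (nbhsx_ballx t _ e'0) => s; rewrite /ball/=.
rewrite ltr_pdivlMr ?ltr_wpDl//; apply: le_lt_trans.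
apply: le_trans (fK _ _) _; rewrite mulrC ler_wpM2l//.
by have := ler_norm K; lra.
Qed.

(** The null set of bad times is covered by an open set U of small measure.
    Adding a multiple of mu (U `&` ]a, t]) to the affine bound compensates,
    inside U, the lack of control on the derivative. *)
Lemma ae_derive_increment (f : R -> R) a b M K : a <= b ->
  (forall s t, a <= s <= b -> a <= t <= b -> `|f s - f t| <= K * `|s - t|) ->
  {ae mu, forall t, a <= t <= b ->
     exists2 D, is_derive t (1 : R) f D & D <= M} ->
  f b - f a <= M * (b - a).
Proof.
move=> ab fK [N [mN N0 NP]]; apply/ler_addgt0Pr => e e0.
pose Q := `|K| + `|M|.
have Q0 : 0 <= Q by rewrite addr_ge0.
pose e' := e / (b - a + Q + 1).
have e'0 : 0 < e' by rewrite divr_gt0//; lra.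
have [U [oU NO Oe]] := @lebesgue_regularity_outer R N e' mN
  (eq_ind_r (fun x => x < +oo)%E (ltry 0) N0) e'0.
have mO : measurable U by exact: open_measurable.
have muO : (mu U < e'%:E)%E.
  have -> : mu U = (mu (U `\` N) + mu (U `&` N))%E by exact: measureDI.
  rewrite (@subset_measure0 _ _ _ mu (U `&` N) N)//.
  - by rewrite adde0.
  - exact: measurableI.
have mOI t s : measurable (U `&` `]t, s]) by apply: measurableI.
have Ofin t s : mu (U `&` `]t, s]) \is a fin_num.
  rewrite ge0_fin_numE//; apply: (@le_lt_trans _ _ (mu U)).
    by apply: le_measure; rewrite ?inE; [exact: mOI|exact: mO|exact: subIsetl].
  exact: lt_trans muO (ltry _).
pose m t := fine (mu (U `&` `]a, t])).
pose w t s := fine (mu (U `&` `]t, s])).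
have itvE t s : t <= s -> mu (`]t, s]%classic : set R) = (s - t)%:E.
  move=> ts; apply: etrans (lebesgue_measure_itv _) _; rewrite /= lte_fin.
  by case: ltP => [//|st]; rewrite (@le_anti _ _ t s) ?subrr// ts.
have w0 t s : 0 <= w t s by exact: fine_ge0.
have ws t s : t <= s -> w t s <= s - t.
  move=> ts; rewrite -lee_fin /w fineK//.
  have : (mu (U `&` `]t, s]) <= mu (`]t, s]%classic : set R))%E.
    by apply: le_measure; rewrite ?inE; [exact: mOI|exact: measurable_itv|exact: subIsetr].
  by rewrite itvE.
have wO t s : t <= s -> `]t, s] `<=` U -> w t s = s - t.
  by move=> ts tsO; rewrite /w setIidr// itvE.
have mD t s : a <= t -> t <= s -> m s = m t + w t s.
  move=> at_ ts; rewrite /m /w -fineD//; congr fine.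
  have -> : U `&` `]a, s] = (U `&` `]a, t]) `|` (U `&` `]t, s]).
    rewrite -setIUr; congr (_ `&` _); apply/seteqP; split => x /=.
      rewrite !in_itv/= => /andP[ax xs]; rewrite ax xs andbT/=.
      by case: leP; [left|right].
    rewrite !in_itv/= => -[/andP[-> xt]|/andP[tx ->]].
      by rewrite (le_trans xt).
    by rewrite (le_lt_trans at_ tx).
  apply: measureU; [exact: mOI|exact: mOI|].
  rewrite -setIIr -[RHS](setI0 U); congr (_ `&` _).
  apply/seteqP; split => // x [] /=; rewrite !in_itv/= => /andP[_ xt].
  by rewrite ltNge xt.
have mb : m b <= e'.
  rewrite -lee_fin /m fineK// ltW//; apply: le_lt_trans muO.
  by apply: le_measure; rewrite ?inE; [exact: mOI|exact: mO|exact: subIsetl].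
pose F t := f t - (M + e') * t - Q * m t.
have m0 : m a = 0 by rewrite /m set_itv_ge ?setI0 ?measure0// bnd_simp ltxx.
suff : F b <= F a.
  rewrite /F m0 mulr0 subr0 => h.
  have : e' * (b - a + Q) <= e.
    rewrite /e' mulrAC ler_pdivrMr; last by lra.
    by rewrite ler_wpM2l//; lra.
  have : Q * m b <= Q * e' by rewrite ler_wpM2l.
  rewrite mulrDr; lra.
have KM : K - M <= Q.
  by rewrite /Q; have := ler_norm K; have := ler_norm (- M); rewrite normrN; lra.
have K1 : 0 < `|K| + 1 by rewrite ltr_wpDl.
apply: right_nonincreasing => // t.
- move=> e1 /andP[at_ tb] e10.
  pose q := e1 / (`|K| + `|M + e'| + 1).
  have q0 : 0 < q by rewrite divr_gt0// !ltr_wpDl// addr_ge0.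
  exists q => // s as_ ts st; rewrite /F (mD s t)//.
  have sab : a <= s <= b by rewrite as_ (le_trans st)// ltW.
  have tab : a <= t <= b by rewrite ltW.
  have := fK t s tab sab; rewrite (ger0_norm (_ : 0 <= t - s)) ?subr_ge0//.
  have : t - s < q by lra.
  rewrite /q ltr_pdivlMr; last by rewrite !ltr_wpDl// addr_ge0.
  have D0 : 0 <= t - s by rewrite subr_ge0.
  have h1 : 0 <= (t - s) * (`|K| - K) by rewrite mulr_ge0// subr_ge0 ler_norm.
  have h2 : 0 <= (t - s) * (`|M + e'| + (M + e')).
    by rewrite mulr_ge0// -lerBlDr sub0r -normrN ler_norm.
  have h3 : 0 <= Q * w s t by rewrite mulr_ge0.
  have := ler_norm (f t - f s).
  move: h1 h2 h3; lra.
move=> /andP[at_ tb].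
have tab : a <= t <= b by rewrite at_ ltW.
have [tN|tN] := pselect (N t).
  have /nbhs_ballP[r /= r0 rO] : nbhs t U by apply: open_nbhs_nbhs; split=> //; exact: NO.
  exists (Num.min r (b - t)); first by rewrite lt_min r0 subr_gt0.
  move=> s ts; rewrite -ltrBlDl lt_min => /andP[sr sb].
  have sab : a <= s <= b by rewrite (le_trans at_ (ltW ts)); lra.
  have tsW := ltW ts; rewrite /F (mD t s)// (wO t s)//; last first.
    move=> x /=; rewrite in_itv/= => /andP[tx xs]; apply: rO.
    by rewrite /ball/= distrC gtr0_norm ?subr_gt0//; lra.
  have := fK s t sab tab; rewrite (gtr0_norm (_ : 0 < s - t)) ?subr_gt0//.
  have h : 0 <= (s - t) * (Q - (K - M) + e').
    by rewrite mulr_ge0//; lra.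
  have := ler_norm (f s - f t).
  move: h; lra.
have [D fD DM] : exists2 D, is_derive t (1 : R) f D & D <= M.
  by apply: contrapT => h; apply: tN; apply: NP => /(_ tab).
have [r r0 rP] := is_derive_approx fD e'0.
exists r => // s ts sr.
have st : `|s - t| < r by rewrite gtr0_norm ?subr_gt0//; lra.
have := rP s st; rewrite (gtr0_norm (_ : 0 < s - t)) ?subr_gt0//.
rewrite ler_norml => /andP[_]; rewrite /F (mD t s)//; last exact: ltW.
have h3 : 0 <= Q * w t s by rewrite mulr_ge0.
have h4 : 0 <= (s - t) * (M - D) by rewrite mulr_ge0// subr_ge0// ltW.
rewrite /GRing.scale/=; move: h3 h4; lra.
Qed.

End Lipschitz.

Section Rademacher.
Variable R : realType.
Let mu : {measure set (measurableTypeR R) -> \bar R} := @lebesgue_measure R.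

(** Both outer measures are infima over the same coverings by half-open
    intervals, and on these they differ at most by the factor M. *)
Lemma lipschitz_stieltjes_null (F : cumulative R R) (M : R) (A : set R) :
  (forall s t, s <= t -> F t - F s <= M * (t - s)) ->
  mu A = 0 -> lebesgue_stieltjes_measure F A = 0.
Proof.
move=> FM A0.
have M0 : 0 <= M.
  have := FM 0 1 ler01; rewrite subr0 mulr1; apply: le_trans.
  by rewrite subr_ge0; exact: (cumulative_is_nondecreasing F).
apply/eqP; rewrite eq_le measure_ge0 andbT; apply/lee_addgt0Pr => e e0.
rewrite add0e.
have e'0 : 0 < e / (M + 1) by rewrite divr_gt0//; lra.
have : (mu A < (e / (M + 1))%:E)%E by rewrite A0 lte_fin.
move=> /ereal_inf_lt[_ [C [mC AC] <-] Ce].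
apply: ereal_inf_le; exists (\sum_(0 <= k <oo) wlength F (C k))%E.
  by exists C.
have wC k : (0 <= wlength F (C k))%E.
  by apply: wlength_ge0.
have wC' k : (0 <= wlength idfun (C k))%E.
  by apply: wlength_ge0.
apply: (@le_trans _ _ (\sum_(0 <= k <oo) (M%:E * wlength idfun (C k)))%E).
  apply: lee_nneseries => [k _ _|k _]; first exact: wC.
  have : ocitv (C k) by exact: mC.
  move=> /ocitvP[->|[[x y] /= xy ->]].
    by rewrite !wlength0 mule0.
  have xy' := ltW xy; by rewrite !wlength_itv_bnd// -EFinM lee_fin FM.
rewrite nneseriesZl; last by move=> k _; exact: wC'.
apply: (@le_trans _ _ (M%:E * (e / (M + 1))%:E)%E).
  by rewrite lee_wpmul2l ?lee_fin// ltW.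
rewrite -EFinM lee_fin mulrCA ger_pMr// ler_pdivrMr; lra.
Qed.

(** The Radon-Nikodym density of the Stieltjes measure has F as an integral, up
    to a constant, and the Lebesgue differentiation theorem applies to it. *)
Lemma cumulative_lipschitz_ae_derivable (F : cumulative R R) (M a b : R) :
  (forall s t, s <= t -> F t - F s <= M * (t - s)) -> a < b ->
  {ae mu, forall t, a < t < b -> derivable F t (1 : R)}.
Proof.
move=> FM ab.
have nuab (x : R) : a <= x ->
    lebesgue_stieltjes_measure F (`]a, x]%classic : set R) = (F x - F a)%:E.
  move=> ax; rewrite /lebesgue_stieltjes_measure /measure_extension.
  rewrite measurable_mu_extE/= ?wlength_itv_bnd//; exact: is_ocitv.
have mD : measurable (`]a, b]%classic : set (measurableTypeR R)).
  exact: measurable_itv.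
have nufin : (lebesgue_stieltjes_measure F (`]a, b]%classic : set R) < +oo)%E.
  by rewrite nuab ?ltry// ltW.
pose nu : {finite_measure set (measurableTypeR R) -> \bar R} := mfrestr mD nufin.
have numu : nu `<< mu.
  move=> A A0 B mB BA; apply: (@lipschitz_stieltjes_null F M) => //.
  apply: A0; first by apply: measurableI => //; exact: measurable_itv.
  exact: subset_trans BA.
pose phi := Radon_Nikodym_SigmaFinite.f nu mu.
have phi_int : mu.-integrable setT phi := Radon_Nikodym_SigmaFinite.f_integrable numu.
have phiE A : measurable A -> nu A = (\int[mu]_(x in A) phi x)%E :=
  @Radon_Nikodym_SigmaFinite.f_integral _ _ _ nu mu numu A.
pose psi x := fine (phi x).
have psiE : EFin \o psi = phi.
  apply/funext => x; rewrite /psi /= fineK//.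
  exact: Radon_Nikodym_SigmaFinite.f_fin_num.
have psi_int : mu.-integrable setT (EFin \o psi) by rewrite psiE.
have psi_loc : locally_integrable setT psi.
  by have := integrable_locally measurableT psi_int; rewrite patch_setT.
have psi_ray y : mu.-integrable `]-oo, y] (EFin \o psi).
  by apply: integrableS psi_int => //.
have := FTC1Ny psi_ray psi_loc.
apply: filterS; first exact: (ae_filter_ringOfSetsType mu).
move=> t [dt _] /andP[at_ tb].
suff h : {near t, (fun x => (\int[mu]_(y in `]-oo, x]) psi y)%R + F a) =1 F}.
  exact: near_eq_derivable h (derivableD dt (derivable_cst _ _ _)).
near=> x.
have ax : a < x by near: x; exact: lt_nbhsr.
have xb : x < b by near: x; exact: lt_nbhsl.
suff -> : (\int[mu]_(y in `]-oo, x]) psi y)%R = F x - F a by rewrite subrK.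
rewrite /Rintegral; have -> : (fun y => (psi y)%:E) = phi by rewrite -psiE.
rewrite -phiE; last exact: measurable_itv.
rewrite -[RHS]/(fine (F x - F a)%:E) -(nuab x (ltW ax)); congr (fine _).
rewrite /nu /= /mfrestr /mrestr; congr (lebesgue_stieltjes_measure F _).
apply/seteqP; split=> y /=; rewrite !in_itv/=.
  by move=> [yx /andP[-> _]].
by move=> /andP[ay yx]; rewrite ay yx (le_trans yx (ltW xb)).
Unshelve. all: by end_near. Qed.

(** Adding a multiple of the identity makes a Lipschitz function monotone, hence
    cumulative. *)
Lemma lipschitz_ae_derivable (f : R -> R) K :
  (forall s t, `|f s - f t| <= K * `|s - t|) ->
  {ae mu, forall t, derivable f t (1 : R)}.
Proof.
move=> fK; pose F t := f t + K * t.
have F_nd : nondecreasing F.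
  move=> s t st; rewrite /F; have := fK s t.
  rewrite distrC ler_norml => /andP[+ _]; rewrite (distrC s) ger0_norm ?subr_ge0//.
  lra.
have f_c := lipschitz_continuous fK.
have F_rc : right_continuous F.
  apply: right_continuousW => t; apply: cvgD; first exact: f_c.
  by apply: cvgMr; exact: cvg_id.
pose F' : cumulative R R := HB.pack F (isCumulative.Build R _ R F F_nd F_rc).
have F_lip s t : s <= t -> F' t - F' s <= (K + K) * (t - s).
  move=> st; rewrite /= /F; have := fK t s.
  rewrite ler_norml => /andP[_]; rewrite ger0_norm ?subr_ge0//.
  lra.
have : {ae mu, forall t, forall n : nat, - n.+1%:R < t < n.+1%:R ->
    derivable F t (1 : R)}.
  apply/ae_foralln => n; apply: (cumulative_lipschitz_ae_derivable F_lip).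
  by rewrite ltrNl; apply: lt_trans (_ : 0 < _); rewrite ?oppr_lt0.
apply: filterS; first exact: (ae_filter_ringOfSetsType mu).
move=> t dF.
have -> : f = F - (fun t => K * t) by apply/funext => x; rewrite /F !fctE addrK.
apply: derivableB => //.
apply: (dF (Num.bound t)); have h := unstable.ltr_bound t.
have h' := unstable.ltrNbound t.
rewrite ltrNl (lt_trans h') ?(lt_trans h) ?ltr_nat//.
Qed.

End Rademacher.

(** * Admissible curves are the curves of bounded pointwise speed *)

Section Admissible.
Variables (R : realType) (d : nat).
Implicit Types (X : set 'rV[R]_d) (k : R -> 'rV[R]_d -> R) (g : R -> 'rV[R]_d).

Lemma max0_le (t : R) : Num.max 0 t = t <-> 0 <= t.
Proof. by split=> [<-|/max_idPr//]; rewrite le_max lexx. Qed.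

Lemma dist_max (c s t : R) : `|Num.max c s - Num.max c t| <= `|s - t|.
Proof.
have := ler_norm (s - t); have := ler_norm (t - s); rewrite (distrC t) ler_norml.
case: (leP c s) => ?; case: (leP c t) => ? ? ?; apply/andP; split; lra.
Qed.

Lemma dist_clamp (a b s t : R) :
  `|Num.max a (Num.min s b) - Num.max a (Num.min t b)| <= `|s - t|.
Proof.
apply: le_trans (dist_max _ _ _) _; have := ler_norm (s - t).
have := ler_norm (t - s); rewrite (distrC t) ler_norml.
case: (leP s b) => ?; case: (leP t b) => ? ? ?; apply/andP; split; lra.
Qed.

Lemma lipschitz_onP g : [lipschitz g t | t in [set t : R | 0 <= t]] ->
  exists2 K, 0 < K &
    forall s t, 0 <= s -> 0 <= t -> enorm (g s - g t) <= K * `|s - t|.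
Proof.
move=> /pinfty_ex_gt0[K K0 gK]; exists (d.+1%:R * K) => [|s t s0 t0].
  by rewrite mulr_gt0.
apply: le_trans (enorm_le_norm _) _; rewrite -mulrA.
apply: ler_pM => //; first by rewrite ler_nat.
by apply: (gK (s, t)).
Qed.

Lemma dot_is_derive g t v D : is_derive t (1 : R) g D ->
  is_derive t (1 : R) (fun s => dot v (g s)) (dot v D).
Proof.
move=> [dg Dg].
have gi (i : 'I_d) : is_derive t (1 : R) (v ord0 i *: fun s => g s ord0 i)
    (v ord0 i *: D ord0 i).
  apply: is_deriveZ; apply: DeriveDef.
    by have /derivable_mxP := dg; exact.
  by rewrite -Dg derive_mx// mxE.
have := is_derive_sum gi.
rewrite (_ : \sum_(i < d) _ = fun s => dot v (g s)) //.
by apply/funext => s; rewrite fct_sumE.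
Qed.

(** Scalar test of the velocity against the displacement v itself: the function
    dot v (g s) has derivative at most enorm v times the allowed speed, which is
    nearly constant around t. *)
Lemma Adm_speed X k g : Adm X k g ->
  (forall t x, 0 <= t -> 0 <= k t x) ->
  (forall t e, 0 <= t -> 0 < e -> exists2 r, 0 < r & forall s, 0 <= s ->
     `|s - t| < r -> k s (g s) <= k t (g t) + e) ->
  forall t, 0 <= t ->
  speed_at_most (fun s => g (Num.max 0 s)) t (k t (g t)).
Proof.
move=> [/lipschitz_onP[K K0 gK] _ [u [_ u1 gu]]] k0 kc t t0 e e0.
have [r r0 rP] := kc t e t0 e0; exists r => // s s'.
have M0 : 0 <= k t (g t) + e by rewrite addr_ge0 ?k0// ltW.
suff main a b : 0 <= a -> a <= b -> `|a - t| < r -> `|b - t| < r ->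
    enorm (g b - g a) <= (k t (g t) + e) * (b - a).
  have {}main a b : 0 <= a -> 0 <= b -> `|a - t| < r -> `|b - t| < r ->
      enorm (g a - g b) <= (k t (g t) + e) * `|a - b|.
    move=> a0 b0 ar br; have [ab|ba] := leP a b.
      by rewrite enorm_distC distrC ger0_norm ?subr_ge0//; exact: main.
    by rewrite ger0_norm ?subr_ge0 ?(ltW ba)//; apply: main => //; exact: ltW.
  have tr (x : R) : `|x - t| < r -> `|Num.max 0 x - t| < r.
    by apply: le_lt_trans; rewrite -{1}((max0_le t).2 t0) dist_max.
  move=> /tr sr /tr s'r; apply: le_trans (main _ _ _ _ sr s'r) _.
  - by rewrite le_max lexx.
  - by rewrite le_max lexx.
  - by rewrite ler_wpM2l// dist_max.
move=> a0 ab ar br; set v := g b - g a.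
have [->|v0] := eqVneq (enorm v) 0; first by rewrite mulr_ge0// subr_ge0.
have {}v0 : 0 < enorm v by rewrite lt0r v0 enorm_ge0.
rewrite -(ler_pM2l v0) -expr2 enormE mulrA {2}/v dotBr.
apply: (@ae_derive_increment R (fun s => dot v (g s)) a b _ (enorm v * K)) => //.
  move=> x y /andP[ax _] /andP[ay _]; rewrite -dotBr.
  have h z : dot v z <= enorm v * enorm z := cauchy_schwarz v z.
  apply: (@le_trans _ _ (enorm v * enorm (g x - g y))).
    by rewrite ler_norml h andbT lerNl -dotNr -(enormN (g x - g y)) h.
  by rewrite -mulrA ler_wpM2l ?(ltW v0)// gK// (le_trans a0).
apply: filterS gu; first exact: (ae_filter_ringOfSetsType lebesgue_measure).
move=> x dx /andP[ax xb]; have x0 := le_trans a0 ax.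
exists (dot v (k x (g x) *: u x)); first exact: dot_is_derive (dx x0).
apply: le_trans (cauchy_schwarz _ _) _; rewrite ler_wpM2l ?(ltW v0)//.
rewrite enormZ ger0_norm ?k0//.
apply: (@le_trans _ _ (k x (g x))); first by rewrite ler_piMr ?k0 ?u1.
apply: rP => //; move: ar br; rewrite !ltr_norml => /andP[? ?] /andP[? ?].
by apply/andP; split; lra.
Qed.

End Admissible.

Section AdmissibleConverse.
Variables (R : realType) (d : nat).
Implicit Types (X : set 'rV[R]_d) (k : R -> 'rV[R]_d -> R) (g : R -> 'rV[R]_d).

(** The limsup of difference quotients along 1/n is measurable everywhere and
    is the derivative wherever the latter exists. *)
Lemma lipschitz_measurable_derivative (f : R -> R) K :
  (forall s t, `|f s - f t| <= K * `|s - t|) ->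
  exists2 D : R -> R, measurable_fun setT D &
    {ae lebesgue_measure, forall t : R, is_derive t (1 : R) f (D t)}.
Proof.
move=> fK.
pose q n t := n.+1%:R * (f (t + n.+1%:R^-1) - f t).
have qK n t : `|q n t| <= K.
  rewrite normrM ger0_norm//; apply: (@le_trans _ _ (n.+1%:R * (K * n.+1%:R^-1))).
    rewrite ler_wpM2l//; apply: le_trans (fK _ _) _.
    by rewrite addrAC subrr add0r ger0_norm.
  by rewrite mulrCA divff// mulr1.
exists (fun t => limn_sup (q ^~ t)).
  apply: measurable_fun_limn_sup.
  - move=> t _; exists K => _ [n _ <-]; exact: le_trans (ler_norm _) (qK n t).
  - move=> t _; exists (- K) => _ [n _ <-].
    by have := qK n t; rewrite ler_norml => /andP[].
  move=> n; apply: continuous_measurable_fun => t.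
  apply: cvgMr; apply: cvgB; last exact: (lipschitz_continuous fK).
  apply: (@continuous_comp _ _ _ (fun x : R => x + n.+1%:R^-1) f).
    by apply: cvgD; [exact: cvg_id|exact: cvg_cst].
  exact: (lipschitz_continuous fK).
have := lipschitz_ae_derivable fK.
apply: filterS; first exact: (ae_filter_ringOfSetsType lebesgue_measure).
move=> t ft; apply: DeriveDef => //; apply/esym.
suff /cvg_limn_inf_sup[_ ->] : q ^~ t @ \oo --> 'D_1 f t by [].
apply/cvgrPdist_le => e e0.
have [r r0 rP] := is_derive_approx (derivableP ft) e0.
have := near_infty_natSinv_lt (PosNum r0); apply: filterS => n /= nr.
have := rP (t + n.+1%:R^-1); rewrite addrAC subrr add0r ger0_norm//.
move=> /(_ nr); rewrite /q /GRing.scale/= => h.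
have n0 : n.+1%:R != 0 :> R by rewrite pnatr_eq0.
set u := f (t + _) - f t in h *; set D := 'D_1 f t in h *.
rewrite (_ : D - _ = - (n.+1%:R * (u - n.+1%:R^-1 * D))); last first.
  by field; rewrite addrC natr1.
rewrite normrN normrM ger0_norm//.
apply: le_trans (ler_wpM2l _ h) _ => //.
by rewrite mulrCA divff// mulr1.
Qed.

Lemma speed_derivative_le g t c D : speed_at_most g t c ->
  is_derive t (1 : R) g D -> enorm D <= c.
Proof.
move=> gt gD; apply/ler_addgt0Pr => e e0.
have e'0 : 0 < e / (d.+1%:R + 1) by rewrite divr_gt0.
have [r r0 rP] := gt _ e'0.
have [r' r'0 r'P] := is_derive_approx gD e'0.
have rr : 0 < Num.min r r' by rewrite lt_min r0.
pose m := Num.min r r' / 2; have m0 : 0 < m by rewrite divr_gt0.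
have mm : m < Num.min r r' by rewrite /m; lra.
have tm : t + m - t = m by rewrite addrAC subrr add0r.
move: (mm); rewrite lt_min => /andP[mr mr'].
have := rP (t + m) t; rewrite tm subrr normr0 gtr0_norm// => /(_ mr r0) h1.
have := r'P (t + m); rewrite tm gtr0_norm// => /(_ mr') h2.
have h3 := enorm_le_norm (g (t + m) - g t - m *: D).
have := enorm_tri (m *: D) (g (t + m) - g t) 0.
rewrite !subr0 enormZ gtr0_norm// (enorm_distC (m *: D)) => h4.
have dd : d%:R <= d.+1%:R :> R by rewrite ler_nat.
set e' := e / _ in e'0 h1 h2; have ee : e = (d.+1%:R + 1) * e'.
  by rewrite /e' mulrC divfK// gt_eqF// ltr_wpDl.
rewrite -(ler_pM2l m0); apply: le_trans h4 _.
have h5 : d%:R * `|g (t + m) - g t - m *: D| <= d.+1%:R * (e' * m).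
  by apply: ler_pM.
rewrite ee; move: h1 h3 h5; nra.
Qed.

(** The control is the velocity divided by the larger of the allowed speed and
    its own norm: this keeps it measurable and in the unit ball also at the
    exceptional times, and changes nothing where the curve is differentiable. *)
Lemma speed_Adm X k g (Kmax : R) :
  (forall t, speed_at_most g t (k (Num.max 0 t) (g t))) ->
  (forall t, 0 <= t -> X (g t)) ->
  (forall t, 0 < k (Num.max 0 t) (g t) <= Kmax) ->
  continuous (fun t : R => k (Num.max 0 t) (g t)) ->
  Adm X k g.
Proof.
move=> gs gX kK kc.
have gK a b : enorm (g a - g b) <= Kmax * `|a - b|.
  wlog ab : a b / b <= a.
    by move=> h; have [/h//|/ltW/h] := leP b a; rewrite enorm_distC distrC.
  rewrite ger0_norm ?subr_ge0//; apply: speed_at_most_lipschitz => // t _.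
  by apply: speed_at_mostW (gs t); have /andP[] := kK t.
have gD i : exists D : R -> R, measurable_fun setT D /\
    {ae lebesgue_measure, forall t : R, is_derive t (1 : R) (fun t => g t ord0 i) (D t)}.
  have [|D mD dD] := @lipschitz_measurable_derivative (fun t => g t ord0 i) Kmax.
    move=> s t; apply: le_trans (gK s t).
    by have := coord_le_enorm (g s - g t) i; rewrite !mxE.
  by exists D.
have /choice[D DP] := gD.
pose V t : 'rV[R]_d := \row_i D i t.
pose h t := k (Num.max 0 t) (g t).
pose H t := Num.max (h t) (enorm (V t)).
have H0 t : 0 < H t by rewrite lt_max /h; have /andP[-> _] := kK t.
have mV : measurable_fun setT (fun t => enorm (V t)).
  apply: measurableT_comp.
    exact: (continuous_measurable_fun (@sqrt_continuous R)).
  apply: measurable_sum => i; apply: measurable_funX.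
  rewrite (_ : (fun x => _) = D i); first by have [] := DP i.
  by apply/funext => t; rewrite mxE.
have mH : measurable_fun setT H.
  by apply: measurable_maxr => //; exact: continuous_measurable_fun.
split => //.
  have PF : ProperFilter (globally ([set t : R | 0 <= t] `*` [set t : R | 0 <= t])).
    by apply: (@globally_properfilter _ _ (0, 0)); split => /=.
  apply: (@klipschitzW _ _ _ Kmax).
  move=> [s t] _ /=; exact: le_trans (norm_le_enorm _) (gK _ _).
exists (fun t => (H t)^-1 *: V t); split.
- move=> i; apply: (@measurable_funS _ _ _ _ setT) => //.
  rewrite (_ : (fun t => _) = (fun t => (H t)^-1 * D i t)); last first.
    by apply/funext => t; rewrite !mxE.
  apply: measurable_funM; last by have [] := DP i.
  rewrite (_ : (fun t => _) = expR \o (fun t => - ln (H t))).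
    apply: measurableT_comp; first exact: measurable_expR.
    apply: measurable_funN.
    exact: (measurableT_comp (@measurable_ln R) mH).
  by apply/funext => t /=; rewrite expRN lnK// posrE.
- move=> t _; rewrite enormZ ger0_norm; last by rewrite invr_ge0 ltW.
  rewrite mulrC.
  by rewrite ler_pdivrMr// mul1r le_max lexx orbT.
have : {ae lebesgue_measure, forall t : R, forall i,
    is_derive t (1 : R) (fun t => g t ord0 i) (D i t)}.
  by apply: filter_forall => i; have [] := DP i.
apply: filterS; first exact: (ae_filter_ringOfSetsType lebesgue_measure).
move=> t dD t0.
have gV : is_derive t (1 : R) g (V t).
  have dg : derivable g t (1 : R).
    by apply/derivable_mxP => i j; rewrite ord1; have [] := dD j.
  apply: DeriveDef => //; rewrite derive_mx//; apply/rowP => i.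
  by rewrite !mxE; have [_ ->] := dD i.
have HE : H t = k t (g t).
  rewrite /H /h (max0_le t).2//; apply/max_idPl.
  by have := speed_derivative_le (gs t) gV; rewrite (max0_le t).2.
by rewrite scalerA HE divff ?scale1r//; have /andP[/gt_eqF] := kK t; rewrite (max0_le t).2// => ->.
Qed.

End AdmissibleConverse.

(** * Second order estimates for C^{1,1} maps *)

Section C11.
Variable R : realType.

Lemma mulmx_norm_le n m (z : 'rV[R]_n) (A : 'M[R]_(n, m)) :
  `|z *m A| <= n%:R * (`|z| * `|A|).
Proof.
have ent p q (M : 'M[R]_(p, q)) i j : `|M i j| <= `|M|.
  rewrite [in leRHS]/Num.Def.normr/= mx_normrE.
  exact: (le_bigmax _ (fun k : 'I_p * 'I_q => `|M k.1 k.2|) (i, j)).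
rewrite [leLHS]/Num.Def.normr/= mx_normrE; apply/bigmax_leP; split.
  by rewrite !mulr_ge0.
move=> [i j] _ /=; rewrite ord1 mxE; apply: le_trans (ler_norm_sum _ _ _) _.
rewrite -[X in X%:R](card_ord n) -sum1_card natr_sum mulr_suml.
by apply: ler_sum => k _; rewrite mul1r normrM ler_pM// ent.
Qed.

Lemma line_is_derive n m (f : 'rV[R]_n -> 'rV[R]_m) x z (t : R) :
  differentiable f (x + t *: z) ->
  is_derive t (1 : R) (fun s => f (x + s *: z)) (z *m jacobian f (x + t *: z)).
Proof.
move=> df; have [dz Dz] : is_derive (x + t *: z) z f (z *m jacobian f (x + t *: z)).
  by rewrite -deriveEjacobian//; apply/derivableP/diff_derivable.
have E : (fun h => h^-1 *: (((fun s : R => f (x + s *: z)) \o shift t) (h *: (1 : R))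
    - f (x + t *: z))) =
    (fun h => h^-1 *: ((f \o shift (x + t *: z)) (h *: z) - f (x + t *: z))).
  apply/funext => h /=; congr (_ *: (f _ - _)).
  by rewrite [h *: 1]mulr1 scalerDl addrCA.
by apply: DeriveDef; [rewrite /derivable E|rewrite /derive E].
Qed.

Lemma scaler_is_derive (V : normedModType R) (v : V) (t : R) :
  is_derive t (1 : R) (fun s => s *: v) v.
Proof.
have lim : h^-1 *: (((fun s : R => s *: v) \o shift t) (h *: (1 : R)) - t *: v)
    @[h --> 0^'] --> v.
  apply: cvg_near_cst; near=> h.
  have h0 : h != 0 by near: h; exact: nbhs_dnbhs_neq.
  by rewrite /= [h *: 1]mulr1 scalerDl addrK scalerA mulVf// scale1r.
by apply: DeriveDef; [apply/cvg_ex; exists v|exact: cvg_lim].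
Unshelve. all: by end_near. Qed.

Lemma segment_mean_value m (c dc : R -> 'rV[R]_m) (B : R) : 0 <= B ->
  (forall t : R, 0 <= t <= 1 -> is_derive t (1 : R) c (dc t)) ->
  (forall t, 0 <= t <= 1 -> `|dc t| <= B) -> `|c 1 - c 0| <= B.
Proof.
move=> B0 dcP dcB; rewrite [leLHS]/Num.Def.normr/= mx_normrE.
apply/bigmax_leP; split=> // -[i j] _ /=; rewrite ord1 !mxE.
have cj (t : R) : 0 <= t <= 1 ->
    is_derive t (1 : R) (fun s => c s ord0 j) (dc t ord0 j).
  move=> /dcP[dct Dct]; apply: DeriveDef.
    by have /derivable_mxP := dct; exact.
  by rewrite -Dct derive_mx// mxE.
have [||t t01 ->] := @MVT_segment R (fun s => c s ord0 j)
    (fun t => dc t ord0 j) 0 1 ler01.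
- by move=> t; rewrite in_itv/= => /andP[t0 t1]; apply: cj; rewrite !ltW.
- apply: derivable_within_continuous => t; rewrite in_itv/= => /cj[]; exact.
rewrite subr0 mulr1; apply: le_trans (dcB t _); last by rewrite in_itv in t01.
rewrite [in leRHS]/Num.Def.normr/= mx_normrE.
exact: (le_bigmax _ (fun k : 'I_1 * 'I_m => `|dc t k.1 k.2|) (ord0, j)).
Qed.

Lemma ball_convex n (q x y : 'rV[R]_n) r t : 0 <= t <= 1 ->
  ball q r x -> ball q r y -> ball q r (x + t *: (y - x)).
Proof.
rewrite -ball_normE /= => /andP[t0 t1] qx qy.
rewrite (_ : q - _ = (1 - t) *: (q - x) + t *: (q - y)); last first.
  by apply/rowP => i; rewrite !mxE; ring.
apply: le_lt_trans (ler_normD _ _) _; rewrite !normrZ.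
rewrite (ger0_norm t0) ger0_norm ?subr_ge0//.
have [->|t'0] := eqVneq t 0; first by rewrite subr0 mul1r mul0r addr0.
have : t * `|q - y| < t * r by rewrite ltr_pM2l// lt0r t'0.
have : (1 - t) * `|q - x| <= (1 - t) * r by rewrite ler_wpM2l ?subr_ge0// ltW.
lra.
Qed.

(** The first order Taylor formula on a small ball, the Lipschitz constant of
    the Jacobian providing the quadratic remainder. *)
Lemma C11_taylor n m (U : set 'rV[R]_n) (f : 'rV[R]_n -> 'rV[R]_m) p :
  open U -> C11_on U f -> U p ->
  exists r C, [/\ 0 < r, 0 <= C, ball p r `<=` U,
    (forall x y, ball p r x -> ball p r y -> `|f y - f x| <= C * `|y - x|) &
    (forall x y, ball p r x -> ball p r y ->
      `|f y - f x - (y - x) *m jacobian f x| <= C * `|y - x| ^+ 2)].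
Proof.
move=> oU [df Jf] Up; have [N nN /pinfty_ex_gt0[K K0 KN]] := Jf p Up.
have : nbhs p (N `&` U) by apply: filterI => //; exact: open_nbhs_nbhs.
move=> /nbhs_ballP[r /= r0 rNU].
have rU : ball p r `<=` U by move=> x /rNU[].
have JK x y : ball p r x -> ball p r y ->
    `|jacobian f x - jacobian f y| <= K * `|x - y|.
  by move=> /rNU[Nx _] /rNU[Ny _]; exact: (KN (x, y)).
pose M := `|jacobian f p| + K * r.
have M0 : 0 <= M by rewrite addr_ge0// mulr_ge0// ltW.
have JM x : ball p r x -> `|jacobian f x| <= M.
  move=> px; have := JK x p px (ballxx _ r0).
  have : `|x - p| <= r by move: px; rewrite -ball_normE/= distrC => /ltW.
  move=> h1 h2; rewrite -[jacobian f x](subrK (jacobian f p)).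
  apply: le_trans (ler_normD _ _) _; rewrite addrC lerD2l.
  by apply: le_trans h2 _; rewrite ler_wpM2l// ltW.
exists r, (n%:R * M + n%:R * K); split => //.
- by rewrite addr_ge0// mulr_ge0// ltW.
- move=> x y px py.
  have := @segment_mean_value _ (fun t => f (x + t *: (y - x)))
    (fun t => (y - x) *m jacobian f (x + t *: (y - x))) (n%:R * (`|y - x| * M)).
  rewrite scale1r scale0r addr0 [x + (y - x)]addrC subrK.
  have -> : n%:R * (`|y - x| * M) = n%:R * M * `|y - x| by ring.
  move=> h; apply: le_trans (h _ _ _) _.
  + by rewrite !mulr_ge0.
  + move=> t t01; apply/line_is_derive/df/rU; exact: ball_convex.
  + move=> t t01; apply: le_trans (mulmx_norm_le _ _) _.
    rewrite -mulrA ler_wpM2l// mulrC ler_wpM2r//; apply: JM; exact: ball_convex.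
  + by rewrite ler_wpM2r// lerDl mulr_ge0// ltW.
- move=> x y px py.
  have := @segment_mean_value _
    (fun t => f (x + t *: (y - x)) - t *: ((y - x) *m jacobian f x))
    (fun t => (y - x) *m jacobian f (x + t *: (y - x)) - (y - x) *m jacobian f x)
    (n%:R * K * `|y - x| ^+ 2).
  rewrite !scale1r !scale0r addr0 [x + (y - x)]addrC subrK subr0.
  rewrite [_ - f x]addrAC.
  move=> h; apply: le_trans (h _ _ _) _.
  + by rewrite !mulr_ge0// ltW.
  + move=> t t01; apply: is_deriveB.
      apply/line_is_derive/df/rU; exact: ball_convex.
    exact: scaler_is_derive.
  + move=> t t01; rewrite -mulmxBr; apply: le_trans (mulmx_norm_le _ _) _.
    have h1 := JK _ _ (ball_convex t01 px py) px.
    rewrite -mulrA ler_wpM2l// expr2 mulrCA ler_wpM2l//.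
    apply: le_trans h1 _; rewrite ler_wpM2l ?(ltW K0)//.
    rewrite addrAC subrr add0r normrZ; move: t01 => /andP[t0 t1].
    by rewrite ger0_norm// ler_piMl.
  + by rewrite ler_wpM2r ?sqr_ge0// lerDr mulr_ge0.
Qed.

End C11.

(** * The local shape of a domain with C^{1,1} boundary *)

Section Charts.
Variables (R : realType) (n : nat).
Implicit Types (Om : set 'rV[R]_n) (q y : 'rV[R]_n).

(** A segment that stays off the boundary cannot leave the open set, since
    Om and its closure agree along it. *)
Lemma segment_closure_stable Om (c : R -> 'rV[R]_n) : open Om ->
  (forall t : R, 0 <= t <= 1 -> {for t, continuous c}) ->
  (forall t : R, 0 <= t <= 1 -> ~ bdry Om (c t)) ->
  closure Om (c 0) -> closure Om (c 1).
Proof.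
move=> oOm cc cb c0.
have clO t : 0 <= t <= 1 -> closure Om (c t) -> Om (c t).
  move=> t01 ct; apply: contrapT => nct; apply: (cb t t01); split => //.
  by move/interior_subset.
pose I : set R := [set` `[0, 1]].
have I01 t : I t <-> 0 <= t <= 1 by rewrite /I /= in_itv.
pose B := I `&` c @^-1` Om.
have cI : connected I := @segment_connected R 0 1.
suff BI : B = I.
  have : I 1 by apply/I01; rewrite lexx ler01.
  by rewrite -BI => -[_ cOm1]; exact: subset_closure.
apply: cI.
- exists 0; have h : (0 <= (0 : R)) && ((0 : R) <= 1) by rewrite lexx ler01.
  by split; [apply/I01|exact: clO].
- exists (interior (c @^-1` Om)); first exact: open_interior.
  apply/seteqP; split=> t [It ct]; split => //; last exact: interior_subset ct.
  by apply: (cc t ((I01 t).1 It)); exact: open_nbhs_nbhs.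
- exists (closure B); first exact: closed_closure.
  apply/seteqP; split=> t [It Bt]; split => //.
    by apply: subset_closure.
  apply: clO; first exact/I01.
  move=> N Nt; have [|s [[_ Os] Ns]] := Bt (c @^-1` N).
    by apply: cc => //; exact/I01.
  by exists (c s).
Qed.

End Charts.

Section Flattening.
Variables (R : realType) (d : nat).
Implicit Types (Om : set 'rV[R]_d) (q y : 'rV[R]_d).

(** Flattening the boundary turns the closure, near a boundary point, into a
    union of some of the two open half-balls and of the equatorial disk; each
    half-ball is in or out as a whole, and such a union is convex. This covers
    a domain that lies on both sides of its boundary. *)
Lemma chart_convex Om (U V : set 'rV[R]_d) (psi chi : 'rV[R]_d -> 'rV[R]_d)
    q r : (0 < d)%N -> open Om -> ball q r `<=` V ->
  (forall y, ball q r y -> {for y, continuous chi}) ->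
  (forall y, V y -> U (chi y) /\ psi (chi y) = y) ->
  (forall x, U x -> chi (psi x) = x) ->
  psi @` (bdry Om `&` U) = flat R d d.-1 `&` V ->
  forall y y', ball q r y -> ball q r y' ->
    closure Om (chi y) -> closure Om (chi y') ->
    forall t, 0 <= t <= 1 -> closure Om (chi (y + t *: (y' - y))).
Proof.
move=> d0 oOm rV chic chiV psiU psiE.
have last_lt : (d.-1 < d)%N by rewrite ltn_predL.
pose h y := y ord0 (Ordinal last_lt).
have flatE y : V y -> flat R d d.-1 y <-> bdry Om (chi y).
  move=> Vy; have [Uy chiK] := chiV y Vy; split=> [fy|By].
    have : (flat R d d.-1 `&` V) y by split.
    by rewrite -psiE => -[m [Bm Um] <-]; rewrite psiU.
  have : (psi @` (bdry Om `&` U)) y by exists (chi y).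
  by rewrite psiE => -[].
have h0 y : h y = 0 -> flat R d d.-1 y.
  move=> hy i ni; rewrite -[RHS]hy; congr (y _ _); apply/val_inj => /=.
  by apply/eqP; rewrite eqn_leq ni andbT -ltnS prednK// ltn_ord.
have hflat y : flat R d d.-1 y -> h y = 0 by move=> /(_ (Ordinal last_lt) (leqnn _)).
have hD y y' t : h (y + t *: (y' - y)) = (1 - t) * h y + t * h y'.
  by rewrite /h !mxE; ring.
have side s y y' : ball q r y -> ball q r y' -> 0 < s * h y -> 0 < s * h y' ->
    closure Om (chi y) -> closure Om (chi y').
  move=> yB y'B sy sy' cy.
  have := @segment_closure_stable R d Om (fun t => chi (y + t *: (y' - y))) oOm.
  rewrite scale0r scale1r addr0 [y + _]addrC subrK => stable.
  apply: stable; [move=> t t01|move=> t t01|exact: cy].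
    have /chic chit := ball_convex t01 yB y'B.
    apply: (@continuous_comp _ _ _ (fun t : R => y + t *: (y' - y)) chi); last exact: chit.
    have [/derivable1_diffP/differentiable_continuous dc _] :=
      scaler_is_derive (y' - y) t.
    by apply: cvgD; [exact: cvg_cst|exact: dc].
  have /rV Vt := ball_convex t01 yB y'B.
  move=> /(flatE _ Vt)/hflat; rewrite hD => e0.
  have : (1 - t) * (s * h y) + t * (s * h y') = 0 by rewrite -(mulr0 s) -e0; ring.
  move: t01 => /andP[t0 t1]; have := mulr_ge0 (_ : 0 <= 1 - t) (ltW sy).
  rewrite subr_ge0 => /(_ t1) h1; have [->|t'0] := eqVneq t 0; first by lra.
  have t00 : 0 < t by rewrite lt0r t'0.
  have := mulr_gt0 t00 sy'; lra.
move=> y y' yB y'B cy cy' t t01.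
set z := y + _; have zB : ball q r z by exact: ball_convex.
have hz := hD y y' t; rewrite -/z in hz.
move: (t01) => /andP[t0 t1].
have [z0|z0|z0] := ltgtP (h z) 0.
- have [y0|y0] := ltP (h y) 0; first by apply: (side (-1) y) => //; lra.
  apply: (side (-1) y') => //; last by lra.
  suff : h y' < 0 by lra.
  rewrite ltNge; apply/negP => y'0; have := mulr_ge0 t0 y'0.
  have := mulr_ge0 (_ : 0 <= 1 - t) y0; rewrite subr_ge0 => /(_ t1); lra.
- have [y0|y0] := ltP 0 (h y); first by apply: (side 1 y) => //; lra.
  apply: (side 1 y') => //; last by lra.
  suff : 0 < h y' by lra.
  rewrite ltNge; apply/negP => y'0; have := mulr_ge0_le0 t0 y'0.
  have := mulr_ge0_le0 (_ : 0 <= 1 - t) y0; rewrite subr_ge0 => /(_ t1); lra.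
- by have /h0/(flatE _ (rV _ zB))[] := z0.
Qed.

End Flattening.

Section LocalPaths.
Variables (R : realType) (d : nat).
Implicit Types (A Om : set 'rV[R]_d) (a b p : 'rV[R]_d).

(** The second order bound on b - a - w is all that is retained from the
    regularity of the boundary. *)
Definition tangent_path A (C : R) a b : Prop :=
  exists c w K, [/\ c 0 = a /\ c 1 = b,
    (forall t : R, 0 <= t <= 1 -> A (c t)),
    (forall s t : R, 0 <= s <= 1 -> 0 <= t <= 1 ->
       enorm (c s - c t) <= K * `|s - t|),
    is_derive (0 : R) (1 : R) c w &
    enorm (b - a - w) <= C * enorm (b - a) ^+ 2].

(** The path is the image of a segment under the inverse chart, and its initial
    velocity is given by the first order Taylor formula. *)
Lemma C11_diffeo_tangent_path Om (U V : set 'rV[R]_d) psi p : (0 < d)%N ->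
  open Om -> open U -> U p -> open V -> C11_diffeo U V psi ->
  psi @` (bdry Om `&` U) = flat R d d.-1 `&` V ->
  exists C r, 0 < r /\ forall a b, closure Om a -> closure Om b ->
    `|a - p| < r -> `|b - p| < r -> tangent_path (closure Om) C a b.
Proof.
move=> d0 oOm oU Up oV [psiUV [psiC [chi [chiVU chiC] [psiK chiK]]]] psiE.
have Vq : V (psi p) by exact: psiUV.
have [r [C [r0 C0 rV lipchi taychi]]] := C11_taylor oV chiC Vq.
have [r1 [C1 [r10 C10 r1U lippsi _]]] := C11_taylor oU psiC Up.
have chic y : ball (psi p) r y -> {for y, continuous chi}.
  by move=> /rV Vy; have [dchi _] := chiC; exact: differentiable_continuous (dchi _ Vy).
have conv : forall y y', ball (psi p) r y -> ball (psi p) r y' ->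
    closure Om (chi y) -> closure Om (chi y') ->
    forall t, 0 <= t <= 1 -> closure Om (chi (y + t *: (y' - y))).
  have chiV y : V y -> U (chi y) /\ psi (chi y) = y.
    by move=> Vy; split; [exact: chiVU|apply: chiK; rewrite inE].
  have psiU x : U x -> chi (psi x) = x by move=> Ux; apply: psiK; rewrite inE.
  exact: chart_convex d0 oOm rV chic chiV psiU psiE.
exists (d.+1%:R * C * C1 ^+ 2), (Num.min r1 (r / (C1 + 1))).
have C11 : 0 < C1 + 1 by lra.
split; first by rewrite lt_min r10 divr_gt0.
move=> a b Aa Ab; rewrite !lt_min => /andP[ar1 ar] /andP[br1 br].
have inB x : `|x - p| < r1 -> `|x - p| < r / (C1 + 1) ->
    ball p r1 x /\ ball (psi p) r (psi x).
  move=> x1 xr; have px : ball p r1 x by rewrite -ball_normE /= distrC.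
  split=> //; rewrite -ball_normE /= distrC.
  apply: le_lt_trans (lippsi _ _ (ballxx _ r10) px) _.
  move: xr; rewrite ltr_pdivlMr// => xr; apply: le_lt_trans xr.
  by rewrite mulrC ler_wpM2l//; lra.
have [pa qa] := inB a ar1 ar; have [pb qb] := inB b br1 br.
have chia : chi (psi a) = a by apply: psiK; rewrite inE; exact: r1U.
have chib : chi (psi b) = b by apply: psiK; rewrite inE; exact: r1U.
pose z := psi b - psi a.
have zab : `|z| <= C1 * `|b - a| by exact: lippsi.
exists (fun t => chi (psi a + t *: z)), (z *m jacobian chi (psi a)), (d%:R * C * `|z|).
split.
- by rewrite scale0r scale1r addr0 /z [psi a + _]addrC subrK.
- by move=> t t01; apply: conv => //; rewrite ?chia ?chib.
- move=> s t s01 t01; apply: le_trans (enorm_le_norm _) _; rewrite -!mulrA ler_wpM2l//.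
  apply: le_trans (lipchi _ _ (ball_convex t01 qa qb) (ball_convex s01 qa qb)) _.
  rewrite ler_wpM2l// opprD addrACA subrr add0r -scalerBl normrZ mulrC.
  exact: lexx.
- have := @line_is_derive R d d chi (psi a) z 0; rewrite scale0r addr0; apply.
  by have [dchi _] := chiC; apply/dchi/rV.
have := taychi _ _ qa qb; rewrite chia chib -/z => h.
apply: le_trans (enorm_le_norm _) _.
apply: (@le_trans _ _ (d.+1%:R * (C * (C1 * `|b - a|) ^+ 2))).
  apply: ler_pM => //; first by rewrite ler_nat.
  by apply: le_trans h _; rewrite ler_wpM2l// ler_pXn2r ?nnegrE ?mulr_ge0.
rewrite (_ : _ * (C * _) = d.+1%:R * C * C1 ^+ 2 * `|b - a| ^+ 2); last by ring.
rewrite ler_wpM2l ?mulr_ge0 ?sqr_ge0//.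
by rewrite ler_pXn2r ?nnegrE ?enorm_ge0// norm_le_enorm.
Qed.

End LocalPaths.

(** * Projection onto the closure of the domain *)

Section Projection.
Variables (R : realType) (d : nat).
Implicit Types (A Om : set 'rV[R]_d) (a b p x y : 'rV[R]_d).

Definition nearest A x a := A a /\ forall b, A b -> enorm (x - a) <= enorm (x - b).

Lemma is_derive_approx_enorm (c : R -> 'rV[R]_d) t D e :
  is_derive t (1 : R) c D -> 0 < e -> exists2 r, 0 < r &
  forall s, `|s - t| < r -> enorm (c s - c t - (s - t) *: D) <= e * `|s - t|.
Proof.
move=> cD e0; have e'0 : 0 < e / d.+1%:R by rewrite divr_gt0.
have [r r0 rP] := is_derive_approx cD e'0; exists r => // s sr.
apply: le_trans (enorm_le_norm _) _.
apply: (@le_trans _ _ (d.+1%:R * (e / d.+1%:R * `|s - t|))).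
  by apply: ler_pM => //; [rewrite ler_nat|exact: rP].
by rewrite !mulrA [_ * e]mulrC -(mulrA e) divff// mulr1.
Qed.

(** The open ball about x through its nearest point misses A, so no velocity
    issued from that point and tangent to A can point into the ball. *)
Lemma nearest_tangent A x a (c : R -> 'rV[R]_d) w : nearest A x a ->
  c 0 = a -> (forall t : R, 0 <= t <= 1 -> A (c t)) ->
  is_derive (0 : R) (1 : R) c w -> dot (x - a) w <= 0.
Proof.
move=> [Aa]; set v := x - a => xa c0 cA cw; rewrite leNgt; apply/negP => eta0.
have xv z : x - z = v - (z - a) by rewrite opprB subrKA.
clearbody v.
set eta := dot _ w in eta0 *; pose M := enorm v.
have M0 : 0 <= M by exact: enorm_ge0.
(* e and, below, t are such that each error term in the expansion of
   the squared norm of x - c t is at most half of t * eta *)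
pose e := eta / (4 * (M + 1)).
have e0 : 0 < e by rewrite divr_gt0// mulr_gt0//; lra.
have [r r0 rP] := is_derive_approx_enorm cw e0.
pose Q := (enorm w + e) ^+ 2 + 1.
have Q0 : 0 < Q by rewrite ltr_wpDl ?sqr_ge0.
pose t := Num.min (Num.min 1 (r / 2)) (eta / (2 * Q)).
have t0 : 0 < t by rewrite !lt_min ltr01 !divr_gt0// mulr_gt0.
have tt1 : t <= 1 by rewrite !ge_min lexx.
have tr : t < r.
  apply: (@le_lt_trans _ _ (r / 2)); last by lra.
  by rewrite !ge_min lexx orbT.
have tQ : t * Q <= eta / 2.
  have : t <= eta / (2 * Q) by rewrite !ge_min lexx !orbT.
  by rewrite invfM mulrA ler_pdivlMr.
have t01 : 0 <= t <= 1 by rewrite (ltW t0).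
have := rP t; rewrite subr0 gtr0_norm// => /(_ tr).
rewrite c0; set rho := (c t - a - _) => h.
have ctE : c t - a = t *: w + rho by rewrite [RHS]addrC subrK.
have := xa _ (cA _ t01); rewrite xv ctE.
rewrite -(@ler_pXn2r _ 2)// ?nnegrE ?enorm_ge0//.
rewrite !enormE dotBl !dotBr (dotC (t *: w + rho) v) -!enormE.
rewrite (dotDr v) dotZr -/eta => h1.
have h2 : - dot v rho <= M * enorm rho.
  by rewrite -dotNr -(enormN rho) cauchy_schwarz.
have h3 : enorm (t *: w + rho) ^+ 2 <= t * eta / 2.
  apply: (@le_trans _ _ (t ^+ 2 * Q)); last first.
    by rewrite expr2 -mulrA -mulrA ler_pM2l.
  apply: (@le_trans _ _ (t ^+ 2 * (enorm w + e) ^+ 2)); last first.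
    by rewrite ler_wpM2l ?sqr_ge0// /Q lerDl.
  rewrite -exprMn ler_pXn2r ?nnegrE ?enorm_ge0//; last first.
    by rewrite mulr_ge0 ?(ltW t0)// addr_ge0 ?enorm_ge0// ltW.
  apply: le_trans (enormD _ _) _; rewrite enormZ gtr0_norm//; lra.
have h4 : M * enorm rho <= t * eta / 4.
  apply: (@le_trans _ _ (M * (e * t))); first by rewrite ler_wpM2l.
  have : e * (M + 1) = eta / 4.
    have M1 : M + 1 != 0 by rewrite gt_eqF// ltr_wpDl.
    by rewrite /e; clearbody M eta; field.
  move=> /(congr1 ( *%R t)); have := mulr_ge0 (ltW t0) (ltW e0); lra.
have : 0 < t * eta by rewrite mulr_gt0.
lra.
Qed.

Lemma tangent_path_proximal A C x a b : nearest A x a -> tangent_path A C a b ->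
  dot (x - a) (b - a) <= C * enorm (x - a) * enorm (b - a) ^+ 2.
Proof.
move=> xa [c [w [K [[c0 c1] cA _ cw ab]]]].
have h := nearest_tangent xa c0 cA cw.
rewrite -[b - a](subrK w) dotDr subrK.
have := cauchy_schwarz (x - a) (b - a - w).
have := ler_wpM2l (enorm_ge0 (x - a)) ab; lra.
Qed.

(** Near p the local paths give the inequality and away from p it follows from
    Cauchy-Schwarz, so a constant is found near each point; compactness makes it
    uniform. *)
Lemma proximal_uniform A : compact A ->
  (forall p, A p -> exists C r, 0 < r /\ forall a b, A a -> A b ->
    `|a - p| < r -> `|b - p| < r -> tangent_path A C a b) ->
  exists2 C, 0 < C & forall x a b, nearest A x a -> A b ->
    dot (x - a) (b - a) <= C * enorm (x - a) * enorm (b - a) ^+ 2.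
Proof.
move=> cA loc.
pose P (C : R) a := A a -> forall x b, nearest A x a -> A b ->
    dot (x - a) (b - a) <= C * enorm (x - a) * enorm (b - a) ^+ 2.
suff : \forall C \near +oo, A `<=` P C.
  move=> /pinfty_ex_gt0[C C0 CP]; exists C => // x a b xa Ab.
  by have [Aa _] := xa; exact: (CP a Aa Aa).
apply: (compact_near_coveringP A).1 => // p Ap.
have [C [r [r0 CP]]] := loc p Ap.
pose C' := Num.max C (2 / r).
exists (ball p (r / 2), [set D | C' < D]).
  split; first by apply: nbhsx_ballx; rewrite divr_gt0.
  by apply: nbhs_pinfty_gt; exact: num_real.
move=> [a D] [/= pa CD] Aa x b xa Ab.
apply: (@le_trans _ _ (C' * enorm (x - a) * enorm (b - a) ^+ 2)); last first.
  by rewrite -!mulrA ler_wpM2r ?mulr_ge0 ?sqr_ge0 ?enorm_ge0// ltW.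
have ap : `|a - p| < r / 2 by move: pa; rewrite -ball_normE /= distrC.
have [br|br] := ltP `|b - p| r.
  apply: le_trans (tangent_path_proximal xa (CP a b Aa Ab _ br)) _; first by lra.
  by rewrite -!mulrA ler_wpM2r ?mulr_ge0 ?sqr_ge0 ?enorm_ge0// le_max lexx.
have ab : r / 2 <= enorm (b - a).
  apply: le_trans (norm_le_enorm _); have := ler_normD (b - a) (a - p).
  rewrite subrKA; lra.
apply: le_trans (cauchy_schwarz _ _) _.
have C1 : 1 <= C' * enorm (b - a).
  apply: (@le_trans _ _ (2 / r * enorm (b - a))); last first.
    by rewrite ler_wpM2r ?enorm_ge0// le_max lexx orbT.
  by rewrite mulrAC ler_pdivlMr// mul1r; lra.
have := ler_wpM2l (mulr_ge0 (enorm_ge0 (x - a)) (enorm_ge0 (b - a))) C1.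
by rewrite mulr1 => /le_trans; apply; rewrite le_eqVlt; apply/orP; left; apply/eqP; ring.
Qed.

(** Pair x - y = (x - a) - (y - b) + (a - b) with a - b; the proximal inequality
    at a and at b bounds the first two products. *)
Lemma nearest_lipschitz A C x y a b :
  (forall x a b, nearest A x a -> A b ->
    dot (x - a) (b - a) <= C * enorm (x - a) * enorm (b - a) ^+ 2) ->
  nearest A x a -> nearest A y b ->
  (1 - C * (enorm (x - a) + enorm (y - b))) * enorm (a - b) <= enorm (x - y).
Proof.
move=> prox xa yb; have [Aa _] := xa; have [Ab _] := yb.
have [->|ab0] := eqVneq (enorm (a - b)) 0; first by rewrite mulr0 enorm_ge0.
have {}ab0 : 0 < enorm (a - b) by rewrite lt0r ab0 enorm_ge0.
have h1 := prox _ _ _ xa Ab; have h2 := prox _ _ _ yb Aa.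
rewrite -(ler_pM2r ab0); apply: le_trans (cauchy_schwarz _ _).
have -> : x - y = (x - a) - (y - b) + (a - b).
  by apply/rowP => i; rewrite !mxE; ring.
rewrite (dotDl _ (a - b)) dotBl -enormE.
move: h1; rewrite -[b - a]opprB dotNr enormN => h1; lra.
Qed.

Lemma closure_compact Om : bounded_set Om -> compact (closure Om).
Proof.
move=> [M [_ MP]]; apply: bounded_closed_compact; last exact: closed_closure.
exists (M + 2); split; first exact: num_real.
move=> N MN x cx; have [y [Oy]] := cx _ (nbhsx_ballx x _ ltr01).
rewrite -ball_normE /= => xy.
have := MP (M + 1) (ltac:(lra)) y Oy; have := ler_normD (x - y) y.
rewrite subrK /=; lra.
Qed.

Lemma nearest_exists Om : Om !=set0 -> bounded_set Om ->
  exists P : 'rV[R]_d -> 'rV[R]_d, forall x,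
    nearest (closure Om) x (P x) /\ Defs.edist Om x = enorm (x - P x).
Proof.
move=> Om0 Omb.
have cA := closure_compact Omb.
suff : forall x, exists a, nearest (closure Om) x a /\ Defs.edist Om x = enorm (x - a).
  by move=> /choice[P PP]; exists P.
move=> x.
have [||a Aa aP] := @EVT_min_rV R d (fun y => enorm (x - y)) (closure Om) _ cA.
- by have [y Oy] := Om0; exists y; exact: subset_closure.
- apply: continuous_subspaceT => y.
  apply: (@continuous_comp _ _ _ (fun y => x - y) (@enorm R d)).
    by apply: (@cvgB _ _ _ (nbhs y)); [exact: cvg_cst|exact: cvg_id].
  exact: enorm_continuous.
exists a; split.
  by split=> [|b Ab]; [rewrite inE in Aa|apply: aP; rewrite inE].
rewrite inE in Aa; rewrite /Defs.edist; set S := [set _ | _ in _].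
have Sa : lbound S (enorm (x - a)).
  by move=> _ [y Oy <-]; apply: aP; rewrite inE; exact: subset_closure.
apply/eqP; rewrite eq_le; apply/andP; split; last first.
  apply: lb_le_inf => //; have [y Oy] := Om0; by exists (enorm (x - y)), y.
apply/ler_addgt0Pr => e e0.
have [y [Oy ya]] := Aa _ (enorm_nbhs a e0).
apply: (@le_trans _ _ (enorm (x - y))).
  by apply: ge_inf; [exists (enorm (x - a))|exists y].
apply: le_trans (enorm_tri x a y) _; rewrite lerD2l enorm_distC ltW//.
Qed.

End Projection.

(** * Lipschitz paths in the closure of the domain *)

Section Joined.
Variables (R : realType) (d : nat).
Implicit Types (A Om : set 'rV[R]_d) (a b p x y : 'rV[R]_d).

Lemma C11_domain_tangent_path Om : (0 < d)%N -> open Om ->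
  C11_submanifold d.-1 (bdry Om) -> forall p, closure Om p ->
  exists C r, 0 < r /\ forall a b, closure Om a -> closure Om b ->
    `|a - p| < r -> `|b - p| < r -> tangent_path (closure Om) C a b.
Proof.
move=> d0 oOm subm p Ap; have [pO|pO] := pselect (interior Om p); last first.
  have [U [V [psi [oU Up oV diffeo psiE]]]] := subm p (conj Ap pO).
  exact: C11_diffeo_tangent_path diffeo psiE.
have /nbhs_ballP[r /= r0 rO] := pO.
exists 0, r; split=> // a b _ _ ap bp.
have inB x : `|x - p| < r -> ball p r x by rewrite -ball_normE /= distrC.
exists (fun t => a + t *: (b - a)), (b - a), (enorm (b - a)); split.
- by rewrite scale0r scale1r addr0 addrC subrK.
- by move=> t t01; apply/subset_closure/rO/ball_convex => //; exact: inB.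
- move=> s t _ _; rewrite opprD addrACA subrr add0r -scalerBl enormZ mulrC.
  exact: lexx.
- rewrite -[X in is_derive _ _ _ X]add0r; apply: is_deriveD; exact: scaler_is_derive.
by rewrite subrr enorm0 mul0r.
Qed.

Definition joined A x y : Prop := exists c K, [/\ c 0 = x, c 1 = y,
  (forall t : R, 0 <= t <= 1 -> A (c t)) &
  (forall s t : R, 0 <= s <= 1 -> 0 <= t <= 1 ->
     enorm (c s - c t) <= K * `|s - t|)].

Lemma joined_refl A x : A x -> joined A x x.
Proof.
by move=> Ax; exists (fun=> x), 0; split=> // s t _ _; rewrite subrr enorm0 mul0r.
Qed.

Lemma joined_trans A y x z : joined A x y -> joined A y z -> joined A x z.
Proof.
move=> [c [K [c0 c1 cA cK]]] [c' [K' [c'0 c'1 c'A c'K]]].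
pose u (t : R) := Num.min 1 (2 * t); pose v (t : R) := Num.max 0 (2 * t - 1).
have u01 t : 0 <= t <= 1 -> 0 <= u t <= 1.
  by move=> /andP[t0 _]; rewrite le_min ge_min lexx ler01/= andbT; lra.
have v01 t : 0 <= t <= 1 -> 0 <= v t <= 1.
  by move=> /andP[_ t1]; rewrite le_max ge_max lexx ler01/=; lra.
have uL s t : `|u s - u t| <= 2 * `|s - t|.
  rewrite /u ler_norml; have := ler_norm (s - t); have := ler_norm (t - s).
  rewrite (distrC t); case: (leP 1 (2 * s)) => ?; case: (leP 1 (2 * t)) => ?;
    move=> ? ?; apply/andP; split; lra.
have vL s t : `|v s - v t| <= 2 * `|s - t|.
  rewrite /v ler_norml; have := ler_norm (s - t); have := ler_norm (t - s).
  rewrite (distrC t); case: (leP 0 (2 * s - 1)) => ?; case: (leP 0 (2 * t - 1)) => ?;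
    move=> ? ?; apply/andP; split; lra.
(* c runs while t <= 1/2 and c' afterwards, the other one resting at y *)
exists (fun t => c (u t) + c' (v t) - y), (2 * `|K| + 2 * `|K'|); split.
- rewrite /u /v mulr0 sub0r min_r// max_l ?oppr_le0// c0 c'0 addrK.
  by [].
- rewrite /u /v mulr1 min_l ?max_r ?c1; last 2 first.
  + by lra.
  + by lra.
  by rewrite (_ : 2 - 1 = 1) ?c'1 1?addrAC ?subrr ?add0r//; lra.
- move=> t t01; have [th|th] := leP (2 * t) 1.
    by rewrite /v max_l ?c'0 ?addrK; [exact/cA/u01|lra].
  by rewrite /u min_l ?c1 1?addrAC ?subrr ?add0r; [exact/c'A/v01|lra].
move=> s t s01 t01; rewrite opprB addrA subrK opprD addrACA.
apply: le_trans (enormD _ _) _; rewrite mulrDl; apply: lerD.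
  apply: le_trans (cK _ _ (u01 _ s01) (u01 _ t01)) _.
  apply: (@le_trans _ _ (`|K| * `|u s - u t|)); first by rewrite ler_wpM2r ?ler_norm.
  by have := ler_wpM2l (normr_ge0 K) (uL s t); lra.
apply: le_trans (c'K _ _ (v01 _ s01) (v01 _ t01)) _.
apply: (@le_trans _ _ (`|K'| * `|v s - v t|)); first by rewrite ler_wpM2r ?ler_norm.
by have := ler_wpM2l (normr_ge0 K') (vL s t); lra.
Qed.

Lemma locally_joined A : connected A ->
  (forall p, A p -> exists2 r, 0 < r & forall a b, A a -> A b ->
    `|a - p| < r -> `|b - p| < r -> joined A a b) ->
  forall x y, A x -> A y -> joined A x y.
Proof.
move=> cA loc x y Ax Ay.
pose B := [set z | A z /\ joined A x z].
suff BA : B = A by have [_ xy] : B y by rewrite BA.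
have ctr (p : 'rV[R]_d) r : 0 < r -> `|p - p| < r by rewrite subrr normr0.
apply: cA.
- by exists x; split => //; exact: joined_refl.
- exists [set z | exists p r, [/\ B p, ball p r z & forall a b, A a -> A b ->
    `|a - p| < r -> `|b - p| < r -> joined A a b]].
    rewrite openE => z [p [r [Bp prz pr]]].
    have : nbhs z (ball p r) by apply: open_nbhs_nbhs; split => //; exact: ball_open.
    by apply: filterS => w prw; exists p, r.
  apply/seteqP; split=> z.
    move=> [Az xz]; split=> //; have [r r0 rP] := loc z Az.
    by exists z, r; split => //; exact: ballxx.
  move=> [Az [p [r [[Ap xp] prz pr]]]]; split=> //.
  have r0 : 0 < r by move: prz; rewrite -ball_normE /=; apply: le_lt_trans.
  apply: joined_trans xp _; apply: pr => //; first exact: ctr.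
  by move: prz; rewrite -ball_normE /= distrC.
- exists (closure B); first exact: closed_closure.
  apply/seteqP; split=> z.
    by move=> Bz; split; [have [] := Bz|exact: subset_closure].
  move=> [Az cz]; split=> //; have [r r0 rP] := loc z Az.
  have [b [[Ab xb] zb]] := cz _ (nbhsx_ballx z _ r0).
  apply: joined_trans xb _; apply: rP => //; last exact: ctr.
  by move: zb; rewrite -ball_normE /= distrC.
Qed.

Lemma C11_domain_joined Om : (0 < d)%N -> open Om -> connected Om ->
  C11_submanifold d.-1 (bdry Om) ->
  forall x y, closure Om x -> closure Om y -> joined (closure Om) x y.
Proof.
move=> d0 oOm cOm subm; apply: locally_joined; first exact: connected_closure.
move=> p /(C11_domain_tangent_path d0 oOm subm)[C [r [r0 rP]]]; exists r => // a b.
move=> Aa Ab ap bp; have [c [w [K [[? ?] ? ? _ _]]]] := rP a b Aa Ab ap bp.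
by exists c, K.
Qed.

End Joined.

(** * Converting a speed deficit into an earlier arrival *)

Section Antiderivative.
Variable R : realType.
Implicit Types (f F G : R -> R).

Lemma MVT_le (f df : R -> R) (s s' c : R) : s' <= s ->
  (forall t : R, s' <= t <= s -> is_derive t (1 : R) f (df t)) ->
  (forall t, s' <= t <= s -> df t <= c) -> f s - f s' <= c * (s - s').
Proof.
move=> ss fd dc; have [||t tss ->] := @MVT_segment R f df s' s ss.
- by move=> t; rewrite in_itv/= => /andP[? ?]; apply: fd; rewrite !ltW.
- by apply: derivable_within_continuous => t; rewrite in_itv/= => /fd[].
by rewrite ler_wpM2r ?subr_ge0// dc//; rewrite in_itv in tss.
Qed.

Lemma same_derivative F G f (a b : R) : a <= b ->
  (forall t : R, a <= t <= b -> is_derive t (1 : R) F (f t)) ->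
  (forall t : R, a <= t <= b -> is_derive t (1 : R) G (f t)) ->
  F b - G b = F a - G a.
Proof.
move=> ab dF dG.
have le (F1 F2 : R -> R) :
    (forall t : R, a <= t <= b -> is_derive t (1 : R) F1 (f t)) ->
    (forall t : R, a <= t <= b -> is_derive t (1 : R) F2 (f t)) ->
    F1 b - F2 b <= F1 a - F2 a.
  move=> d1 d2; rewrite -subr_le0 -(mul0r (b - a)).
  apply: (@MVT_le (fun t => F1 t - F2 t) (fun=> 0)) => // t tab.
  rewrite -(subrr (f t)); apply: is_deriveB; [exact: d1|exact: d2].
by have := le _ _ dF dG; have := le _ _ dG dF; lra.
Qed.

Lemma right_antiderivative f (c : R) : continuous f ->
  exists F, forall t : R, c < t -> is_derive t (1 : R) F (f t).
Proof.
move=> cf; exists (fun x => \int[lebesgue_measure]_(y in `[c, x]) f y)%R => t ct.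
have t1 : t < t + 1 by rewrite ltrDl.
have fi : lebesgue_measure.-integrable `[c, t + 1] (EFin \o f).
  apply: continuous_compact_integrable; first exact: segment_compact.
  exact: continuous_subspaceT.
have [dF Ft] := continuous_FTC1_closed t1 fi ct (cf t).
exact: DeriveDef dF (etrans (esym (derive1E _ _)) Ft).
Qed.

Lemma continuous_antiderivative f : continuous f ->
  exists F, forall t : R, is_derive t (1 : R) F (f t).
Proof.
move=> cf; have [F FP] := right_antiderivative (-1) cf.
have cfN : continuous (fun x => f (- x)).
  by move=> x; apply: continuous_comp; [exact: opp_continuous|exact: cf].
have [G GP] := right_antiderivative (-1) cfN.
pose H x := - G (- x).
have HP (t : R) : t < 1 -> is_derive t (1 : R) H (f t).
  move=> t1; have tN1 : -1 < - t by rewrite ltrN2.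
  have h : is_derive t (1 : R) (fun x => G (- x)) (- f t).
    have := @is_derive1_comp R G (fun x : R => - x) t (f (- - t)) (-1).
    rewrite opprK mulrN1; apply; first by have := GP _ tN1; rewrite opprK.
  by rewrite -(opprK (f t)); exact: is_deriveN.
pose S x := if 0 <= x then F x - F 0 else H x - H 0.
have SF (t : R) : -1 < t -> S t = F t - F 0.
  move=> t1; rewrite /S; case: ifPn => //; rewrite -ltNge => t0.
  have := @same_derivative F H f t 0 (ltW t0); rewrite -/(H t) => h.
  have : F 0 - H 0 = F t - H t; last by lra.
  by apply: h => u /andP[tu u0]; [apply: FP; lra|apply: HP; lra].
have SH (t : R) : t < 1 -> S t = H t - H 0.
  move=> t1; rewrite /S; case: ifPn => // t0.
  have : F t - H t = F 0 - H 0; last by lra.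
  by apply: (@same_derivative F H f) => // u /andP[u0 ut];
    [apply: FP; lra|apply: HP; lra].
exists S => t; have [t0|t0] := ltP t 0.
  apply: (@near_eq_is_derive _ _ _ (fun x => H x - H 0)).
    have t1 : t < 1 by lra.
    by apply: filterS (lt_nbhsl t1) => x x1; rewrite SH.
  rewrite -[f t]subr0; apply: is_deriveB; apply: HP; lra.
apply: (@near_eq_is_derive _ _ _ (fun x => F x - F 0)).
  have t1 : -1 < t by lra.
  by apply: filterS (lt_nbhsr t1) => x x1; rewrite SF.
rewrite -[f t]subr0; apply: is_deriveB; apply: FP; lra.
Qed.

End Antiderivative.

Section HeadStart.
Variable R : realType.

(** Take e t = al x exp (- Lam x), where x is the positive part of t - a: with
    Lam = L + 1 / (b - a) the derivative is at most - L e from b on, and the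
    exponential decay keeps e positive. *)
Lemma head_start (a b L al : R) : a < b -> 0 < L -> 0 < al ->
  exists e : R -> R, [/\ forall t, t <= a -> e t = 0,
    forall t, a < t -> 0 < e t,
    forall s s', `|e s - e s'| <= al * `|s - s'| &
    forall t ep, b < t -> 0 < ep -> exists2 r, 0 < r & forall s s', s' <= s ->
      `|s - t| < r -> `|s' - t| < r -> e s - e s' <= (ep - L * e t) * (s - s')].
Proof.
move=> ab L0 al0; pose Lam := L + (b - a)^-1.
have ba0 : 0 < b - a by rewrite subr_gt0.
have Lam0 : 0 < Lam by rewrite addr_gt0// invr_gt0.
pose psi (x : R) := x * expR (- Lam * x).
pose dpsi (x : R) := (1 - Lam * x) * expR (- Lam * x).
have psi_d (x : R) : is_derive x (1 : R) psi (dpsi x).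
  have h1 : is_derive x (1 : R) (fun y => - Lam * y) (- Lam).
    by apply: is_derive_eq; rewrite /GRing.scale/= mulr1.
  have h2 : is_derive x (1 : R) (fun y => expR (- Lam * y)) (expR (- Lam * x) * - Lam).
    by apply: (@is_derive1_comp R expR).
  apply: is_derive_eq; rewrite /GRing.scale/= /dpsi; ring.
have dpsi1 x : 0 <= x -> `|dpsi x| <= 1.
  move=> x0; rewrite normrM (ger0_norm (expR_ge0 _)) mulNr expRN.
  rewrite ler_pdivrMr ?expR_gt0// mul1r; apply: le_trans (expR_ge1Dx _).
  have := mulr_ge0 (ltW Lam0) x0; rewrite ler_norml => h; apply/andP; split; lra.
have psiL s s' : 0 <= s -> 0 <= s' -> `|psi s - psi s'| <= `|s - s'|.
  wlog ss : s s' / s' <= s.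
    by move=> h s0 s'0; have [/h|/ltW/h] := leP s' s; [exact|rewrite distrC (distrC s); exact].
  move=> s0 s'0; rewrite (ger0_norm (_ : 0 <= s - s')) ?subr_ge0// ler_norml.
  have dpsi_b t : s' <= t <= s -> `|dpsi t| <= 1.
    by move=> /andP[st _]; apply: dpsi1; exact: le_trans st.
  apply/andP; split; last first.
    rewrite -[leRHS]mul1r; apply: (MVT_le ss (fun t _ => psi_d t)) => t /dpsi_b.
    exact: le_trans (ler_norm _).
  have dN (t : R) : is_derive t (1 : R) (fun t => - psi t) (- dpsi t) by exact: is_deriveN.
  have := @MVT_le R (fun t => - psi t) (fun t => - dpsi t) s s' 1 ss (fun t _ => dN t).
  rewrite mul1r => h.
  have : - psi s - - psi s' <= s - s'.
    apply: h => t /dpsi_b; rewrite ler_norml; lra.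
  lra.
pose m t := Num.max 0 (t - a).
have m0 t : 0 <= m t by rewrite le_max lexx.
have mL s s' : `|m s - m s'| <= `|s - s'|.
  by apply: le_trans (dist_max _ _ _) _; rewrite opprB addrA subrK.
exists (fun t => al * psi (m t)); split.
- by move=> t ta; rewrite /m max_l ?subr_le0// /psi mul0r mulr0.
- move=> t at_; rewrite /m max_r ?subr_ge0 1?ltW// /psi !mulr_gt0 ?expR_gt0//.
  by rewrite subr_gt0.
- move=> s s'; rewrite -mulrBr normrM gtr0_norm// ler_pM2l//.
  exact: le_trans (psiL _ _ (m0 _) (m0 _)) (mL _ _).
move=> t ep bt ep0.
have e'0 : 0 < ep / (L * al) by rewrite divr_gt0// mulr_gt0.
exists (Num.min (t - b) (ep / (L * al))) => [|s s' ss].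
  by rewrite lt_min subr_gt0 bt.
rewrite !lt_min => /andP[sb sr] /andP[s'b s'r].
have mE u : `|u - t| < t - b -> m u = u - a.
  by rewrite ltr_norml => /andP[? _]; rewrite /m max_r//; lra.
rewrite (mE s sb) (mE s' s'b) -mulrBr.
have ssa : s' - a <= s - a by rewrite lerD2r.
have bound u : s' - a <= u <= s - a -> dpsi u <= ep / al - L * psi (m t).
  move=> /andP[s'u us].
  have uba : b - a <= u by move: s'b; rewrite ltr_norml => /andP[? _]; lra.
  have u0 : 0 <= u by lra.
  have h1 : 1 - Lam * u <= - L * u.
    have : 1 <= (b - a)^-1 * u by rewrite mulrC ler_pdivlMr// mul1r.
    rewrite /Lam; lra.
  have h2 : dpsi u <= - L * psi u.
    by rewrite /dpsi /psi mulrA ler_wpM2r// expR_ge0.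
  have h3 : psi (m t) - psi u <= ep / (L * al).
    apply: le_trans (ler_norm _) _; apply: le_trans (psiL _ _ (m0 _) u0) _.
    rewrite mE ?subrr ?normr0 ?subr_gt0//; move: sr s'r.
    rewrite !ltr_norml ler_norml => /andP[? ?] /andP[? ?]; apply/andP; split; lra.
  have h4 : L * (ep / (L * al)) = ep / al by field; rewrite !gt_eqF.
  have := ler_wpM2l (ltW L0) h3; rewrite mulrBr h4; lra.
have := @MVT_le R psi dpsi (s - a) (s' - a) _ ssa (fun u _ => psi_d u) bound.
rewrite (_ : s - a - (s' - a) = s - s'); last by ring.
move=> /(ler_wpM2l (ltW al0)) /le_trans; apply.
have al1 : al * (ep / al) = ep by rewrite mulrCA divff ?mulr1// gt_eqF.
by rewrite -[in leRHS]al1 le_eqVlt; apply/orP; left; apply/eqP; ring.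
Qed.

End HeadStart.

Section Faster.
Variables (R : realType) (d : nat).

Lemma continuous_ivt (F : R -> R) (s t v : R) : s <= t -> continuous F ->
  F s <= v <= F t -> exists2 u, s <= u <= t & F u = v.
Proof.
move=> st cF vF.
have := @IVT R F s t v st (continuous_subspaceT cF); rewrite minEle maxEle.
have -> : F s <= F t by case/andP: vF => /le_trans; exact.
by move=> /(_ vF)[u]; rewrite in_itv/= => ust Fu; exists u.
Qed.

(** The deficit is invested in a head start e, and the curve is then followed
    ahead of its schedule: the clock S has a derivative that bounds the speed,
    and zeta is, at time t, where eta is when S reads S t + e t. The allowed
    speed depends on time in a merely continuous way, so nothing is known of it
    on a curve shifted in time; zeta is only shifted in space, by e t at most,
    which changes the allowed speed by at most L * e t. *)
Lemma faster_curve (eta : R -> 'rV[R]_d) (f : R -> 'rV[R]_d -> R) (K : R -> R)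
    (a b t2 K0 sig L : R) :
  continuous K -> 0 < K0 -> (forall t, K0 <= K t) ->
  (forall t, speed_at_most eta t (K t)) ->
  (forall t, K t <= f t (eta t)) ->
  0 < sig -> (forall t, a <= t <= b -> K t + sig <= f t (eta t)) ->
  0 < L -> (forall t x y, `|f t x - f t y| <= L * enorm (x - y)) ->
  a < b -> b <= t2 ->
  exists zeta : R -> 'rV[R]_d,
    [/\ forall t, exists s, zeta t = eta s,
        forall t, t <= a -> zeta t = eta t,
        exists2 t', a <= t' < t2 & zeta t' = eta t2 &
        forall t, speed_at_most zeta t (f t (zeta t))].
Proof.
move=> cK K00 KK0 etaK Kf sig0 slack L0 fL ab bt2.
have [S SP] := continuous_antiderivative cK.
have cS : continuous S.
  by move=> u; have [/derivable1_diffP/differentiable_continuous] := SP u.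
have Slow s s' : s' <= s -> K0 * (s - s') <= S s - S s'.
  move=> ss; have := @MVT_le R (fun t => - S t) (fun t => - K t) s s' (- K0) ss.
  have -> : - S s - - S s' = - (S s - S s') by ring.
  rewrite mulNr lerN2; by apply => t _; rewrite lerN2.
(* al <= K0 keeps the shifted clock nondecreasing; the other bound lets the
   growth of e and its effect on the allowed speed fit into the deficit *)
pose al := Num.min K0 (sig / (L * (b - a) + 1)).
have Lba : 0 < L * (b - a) + 1 by rewrite ltr_wpDl// mulr_ge0 ?subr_ge0// ltW.
have al0 : 0 < al by rewrite lt_min K00 divr_gt0.
have alK : al <= K0 by rewrite ge_min lexx.
have als : al * (L * (b - a)) + al <= sig.
  have : al <= sig / (L * (b - a) + 1) by rewrite ge_min lexx orbT.
  by rewrite ler_pdivlMr// mulrDr mulr1.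
have [e [e_a e0 eL e_b]] := head_start ab L0 al0.
have e_ge0 t : 0 <= e t.
  by have [/e_a->//|/e0/ltW] := leP t a.
have /choice[theta thetaP] : forall t, exists u, t <= u /\ S u = S t + e t.
  move=> t; have tu : t <= t + e t / K0 by rewrite lerDl divr_ge0// ltW.
  have h : S t <= S t + e t <= S (t + e t / K0).
    rewrite lerDl e_ge0/= -lerBrDl; apply: le_trans (Slow _ _ tu).
    by rewrite addrAC subrr add0r mulrC divfK ?gt_eqF.
  by have [u /andP[tu' _] Su] := continuous_ivt tu cS h; exists u.
have Sinj u v : S u = S v -> u = v.
  wlog uv : u v / u <= v.
    by move=> h; have [/h|/ltW/h h' /esym/h'] := leP u v; [exact|].
  move=> Suv; have := Slow _ _ uv; rewrite Suv subrr pmulr_rle0// => vu.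
  by apply/le_anti; rewrite uv -subr_le0.
have etaS u v : u <= v -> enorm (eta v - eta u) <= S v - S u.
  by move=> uv; apply: (speed_at_most_increment uv) => t _; exact: etaK.
have etaSn u v : enorm (eta v - eta u) <= `|S v - S u|.
  have [uv|/ltW vu] := leP u v; first exact: le_trans (etaS _ _ uv) (ler_norm _).
  by rewrite enorm_distC distrC; apply: le_trans (etaS _ _ vu) (ler_norm _).
have theta_near t : enorm (eta (theta t) - eta t) <= e t.
  have [tt' St'] := thetaP t; apply: le_trans (etaS _ _ tt') _.
  by rewrite St' addrAC subrr add0r.
have fe t : f t (eta t) - L * e t <= f t (eta (theta t)).
  have := fL t (eta t) (eta (theta t)); rewrite enorm_distC ler_norml => /andP[_ h].
  have := ler_wpM2l (ltW L0) (theta_near t); lra.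
exists (eta \o theta); split.
- by move=> t; exists (theta t).
- move=> t ta /=; congr eta; apply: Sinj; have [_ ->] := thetaP t.
  by rewrite e_a// addr0.
- have at2 : a <= t2 by rewrite (le_trans (ltW ab)).
  have cSe : continuous (fun t => S t + e t).
    by move=> u; apply: cvgD; [exact: cS|exact: (lipschitz_continuous eL)].
  have h : S a + e a <= S t2 <= S t2 + e t2.
    rewrite e_a// addr0 lerDl e_ge0 andbT -subr_ge0.
    by apply: le_trans (Slow _ _ at2); rewrite mulr_ge0 ?subr_ge0// ltW.
  have [t' /andP[at' t't2] t'E] := continuous_ivt at2 cSe h.
  exists t'.
    rewrite at' lt_neqAle t't2 andbT; apply/eqP => tt.
    have := e0 t2 (lt_le_trans ab bt2); move: t'E; rewrite tt; lra.
  by rewrite /=; congr eta; apply: Sinj; have [_ ->] := thetaP t'.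
move=> t ep ep0 /=.
have [r1 r10 r1P] : exists2 r, 0 < r & forall s, `|s - t| < r -> K s <= K t + ep / 2.
  have ep2 : 0 < ep / 2 by lra.
  have /cvgrPdist_lt/(_ _ ep2)/nbhs_ballP[r /= r0 rP] := cK t.
  exists r => // s st; have /rP : ball t r s by rewrite /ball/= distrC.
  by rewrite /= ltr_norml => /andP[]; lra.
have clock s s' : s' <= s -> `|s - t| < r1 -> `|s' - t| < r1 ->
    enorm (eta (theta s) - eta (theta s')) <=
    (K t + ep / 2) * (s - s') + (e s - e s').
  move=> ss sr s'r; apply: le_trans (etaSn _ _) _.
  have [_ ->] := thetaP s; have [_ ->] := thetaP s'.
  have -> : S s + e s - (S s' + e s') = (S s - S s') + (e s - e s') by ring.
  rewrite ger0_norm; last first.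
    have := eL s s'; rewrite (ger0_norm (_ : 0 <= s - s')) ?subr_ge0//.
    rewrite ler_norml => /andP[h _]; have := Slow _ _ ss.
    have : al * (s - s') <= K0 * (s - s') by rewrite ler_wpM2r ?subr_ge0.
    lra.
  rewrite lerD2r; apply: (MVT_le ss (fun u _ => SP u)) => u /andP[s'u us].
  apply: r1P; move: sr s'r; rewrite !ltr_norml => /andP[? ?] /andP[? ?].
  by apply/andP; split; lra.
suff [r2 r20 r2P] : exists2 r, 0 < r & forall s s', s' <= s ->
    `|s - t| < r -> `|s' - t| < r ->
    e s - e s' <= (f t (eta (theta t)) - K t + ep / 2) * (s - s').
  exists (Num.min r1 r2) => [|s s']; first by rewrite lt_min r10.
  wlog ss : s s' / s' <= s.
    by move=> h; have [/h//|/ltW/h h' ? ?] := leP s' s; rewrite enorm_distC distrC h'.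
  rewrite !lt_min => /andP[sr1 sr2] /andP[s'r1 s'r2].
  rewrite ger0_norm ?subr_ge0//; apply: le_trans (clock _ _ ss sr1 s'r1) _.
  have := r2P _ _ ss sr2 s'r2; lra.
have al_up s s' : s' <= s -> e s - e s' <= al * (s - s').
  move=> ss; apply: le_trans (ler_norm _) _; apply: le_trans (eL _ _) _.
  by rewrite ger0_norm ?subr_ge0.
have [ta|at_] := ltP t a.
  exists (a - t) => [|s s' ss]; first by rewrite subr_gt0.
  rewrite !ltr_norml => /andP[_ sa] /andP[_ s'a].
  rewrite !e_a ?subrr; [|lra|lra]; rewrite mulr_ge0 ?subr_ge0//.
  have := fe t; have := Kf t; rewrite e_a ?(ltW ta)// mulr0 subr0; lra.
have [tb|bt] := leP t b.
  exists 1 => // s s' ss _ _; apply: le_trans (al_up _ _ ss) _.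
  rewrite ler_wpM2r ?subr_ge0//.
  have tab : a <= t <= b by rewrite at_.
  have := slack _ tab; have := fe t.
  have : e t <= al * (b - a).
    have := al_up _ _ at_; rewrite (e_a a)// subr0 => /le_trans; apply.
    by rewrite ler_pM2l// lerD2r.
  move=> /(ler_wpM2l (ltW L0)); lra.
have ep2 : 0 < ep / 2 by lra.
have [r r0 rP] := e_b t _ bt ep2; exists r => // s s' ss sr s'r.
apply: le_trans (rP _ _ ss sr s'r) _; rewrite ler_wpM2r ?subr_ge0//.
have := fe t; have := Kf t; lra.
Qed.

End Faster.

(** * The projection of a penalized curve *)

Section Regularity.
Variables (R : realType) (d : nat).
Implicit Types (Om : set 'rV[R]_d) (g : R -> 'rV[R]_d) (k : R -> 'rV[R]_d -> R).

Lemma enorm_cvg (T : topologicalType) (F : set_system T) (g : T -> 'rV[R]_d) y :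
  Filter F -> (forall e, 0 < e -> \forall x \near F, enorm (g x - y) < e) ->
  g @ F --> y.
Proof.
move=> FF gy; apply/(@cvgrPdist_lt _ _ _ F) => e e0.
apply: filterS (gy e e0) => x; apply: le_lt_trans.
by rewrite distrC norm_le_enorm.
Qed.

Lemma speed_continuous g c : (forall t, speed_at_most g t (c t)) -> continuous g.
Proof.
move=> gc t; apply: enorm_cvg => e e0.
have [r r0 rP] := speed_at_most_continuous (gc t) e0.
apply: filterS (nbhsx_ballx t _ r0) => s; rewrite /ball/= distrC; exact: rP.
Qed.

Lemma max0_continuous : continuous (fun s : R => Num.max 0 s).
Proof.
by apply: (@lipschitz_continuous _ _ 1) => s t; rewrite mul1r dist_max.
Qed.

Lemma speed_on_continuous (Kmin Kmax L : R) k g : speed_on setT Kmin Kmax L k ->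
  continuous g -> continuous (fun s : R => k (Num.max 0 s) (g s)).
Proof.
move=> [kc _ _] cg t.
pose D := [set p : R * 'rV[R]_d | 0 <= p.1 /\ [set: 'rV[R]_d] p.2].
have Dt s : D (Num.max 0 s, g s) by split => //=; rewrite le_max lexx.
have cp : (fun s : R => (Num.max 0 s, g s)) @ t --> within D (nbhs (Num.max 0 t, g t)).
  move=> N /=.
  have h : (fun s : R => (Num.max 0 s, g s)) @ t --> (Num.max 0 t, g t).
    exact: (cvg_pair (@max0_continuous t) (cg t)).
  move=> /h hN; apply: (@filterS _ (nbhs t) _ _ _ _ hN) => s /=.
  by apply; exact: Dt.
have kt := (subspace_continuousP D _).1 kc _ (Dt t).
by move=> N kN; exact: cp _ (kt N kN).
Qed.

Lemma speed_on_Adm (X : set 'rV[R]_d) (Kmin Kmax L : R) k g : 0 < Kmin ->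
  speed_on setT Kmin Kmax L k ->
  (forall t, speed_at_most g t (k (Num.max 0 t) (g t))) ->
  (forall t, X (g t)) -> Adm X k g.
Proof.
move=> Kmin0 ks gs gX; have [_ kK _] := ks; apply: (@speed_Adm R d X k g Kmax) => //.
- move=> t; have t0 : 0 <= Num.max 0 t by rewrite le_max lexx.
  by have /andP[/(lt_le_trans Kmin0) -> ->] := kK _ (g t) t0 I.
- exact: speed_on_continuous ks (speed_continuous gs).
Qed.

Definition projects Om (P : 'rV[R]_d -> 'rV[R]_d) :=
  forall x, nearest (closure Om) x (P x) /\ Defs.edist Om x = enorm (x - P x).

Section WithProjection.
Variables (Om : set 'rV[R]_d) (P : 'rV[R]_d -> 'rV[R]_d).
Hypothesis POm : projects Om P.

Lemma distance_ge0 x : 0 <= Defs.edist Om x.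
Proof. by have [_ ->] := POm x; exact: enorm_ge0. Qed.

Lemma distance_lipschitz x y : `|Defs.edist Om x - Defs.edist Om y| <= enorm (x - y).
Proof.
have h u v : Defs.edist Om u - Defs.edist Om v <= enorm (u - v).
  have [[_ nu] ->] := POm u; have [[Av _] ->] := POm v.
  have := nu _ Av; have := enorm_tri u v (P v); lra.
rewrite ler_norml h andbT lerNl opprB enorm_distC; exact: h.
Qed.

Lemma distance_closure x : closure Om x -> Defs.edist Om x = 0.
Proof.
move=> Ax; have [[_ nx] ->] := POm x; apply/le_anti; rewrite enorm_ge0 andbT.
by rewrite -(enorm0 R d) -(subrr x) nx.
Qed.

Lemma distance_eq0 x : Defs.edist Om x = 0 -> closure Om x.
Proof.
have [[Ax _] ->] := POm x; move=> /enorm_eq0/eqP; rewrite subr_eq0 => /eqP ->.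
exact: Ax.
Qed.

Lemma proj_closure x : closure Om x -> P x = x.
Proof.
move=> /distance_closure; have [_ ->] := POm x; move=> /enorm_eq0/eqP.
by rewrite subr_eq0 => /eqP.
Qed.

Lemma distance_curve_continuous g : continuous g ->
  continuous (fun s : R => Defs.edist Om (g s)).
Proof.
move=> cg t; apply/cvgrPdist_lt => e e0.
have gt : \forall s \near t, enorm (g s - g t) < e := cg t _ (enorm_nbhs (g t) e0).
apply: filterS gt => s /= h.
by apply: le_lt_trans (distance_lipschitz _ _) _; rewrite enorm_distC.
Qed.

Lemma kpen_continuous (Kmin Kmax L eps : R) k g : speed_on setT Kmin Kmax L k ->
  continuous g -> continuous (fun s : R => kpen Om eps k (Num.max 0 s) (g s)).
Proof.
move=> ks cg t; apply: cvgM; first exact: speed_on_continuous ks cg t.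
apply: (@continuous_comp _ _ _ (fun s : R => 1 - eps^-1 * Defs.edist Om (g s))
  (fun y => Num.max 0 y)); last exact: max0_continuous.
have h : (fun s : R => Defs.edist Om (g s)) @ t --> Defs.edist Om (g t).
  exact: distance_curve_continuous.
apply: (@cvgB _ _ _ (nbhs t)); first exact: cvg_cst.
by apply: cvgMr; exact: h.
Qed.

Lemma kpen_ge0 (Kmin Kmax L eps t : R) k x : 0 < Kmin ->
  speed_on setT Kmin Kmax L k -> 0 <= t -> 0 <= kpen Om eps k t x.
Proof.
move=> Kmin0 [_ kK _] t0; rewrite mulr_ge0 ?le_max ?lexx//.
by have /andP[+ _] := kK t x t0 I; apply: le_trans; exact: ltW.
Qed.

Lemma Adm_kpen_speed (Kmin Kmax L eps : R) k g : 0 < Kmin ->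
  speed_on setT Kmin Kmax L k -> Adm setT (kpen Om eps k) g ->
  forall t, 0 <= t ->
  speed_at_most (fun s => g (Num.max 0 s)) t (kpen Om eps k t (g t)).
Proof.
move=> Kmin0 ks Ag; apply: (Adm_speed Ag).
  by move=> t x t0; exact: kpen_ge0 ks t0.
move=> t e t0 e0.
have [/lipschitz_onP[K K0 gK] _ _] := Ag.
have cg : continuous (fun s : R => g (Num.max 0 s)).
  move=> u; apply: enorm_cvg => e' e'0.
  have e'K : 0 < e' / K by rewrite divr_gt0.
  apply: filterS (nbhsx_ballx u _ e'K) => s; rewrite /ball/= distrC => us.
  apply: le_lt_trans (gK _ _ _ _) _; rewrite ?le_max ?lexx//.
  apply: le_lt_trans (ler_wpM2l (ltW K0) (dist_max _ _ _)) _.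
  by rewrite mulrC -ltr_pdivlMr.
have := @kpen_continuous _ _ _ eps _ _ ks cg t.
move=> /cvgrPdist_lt/(_ _ e0)/nbhs_ballP[r /= r0 rP]; exists r => // s s0 st.
have /rP : ball t r s by rewrite /ball/= distrC.
rewrite /= (max0_le t).2// (max0_le s).2// ltr_norml => /andP[]; lra.
Qed.

End WithProjection.

Lemma speed_clamp g (c : R -> R) t1 t2 : t1 <= t2 ->
  (forall t, t1 <= t <= t2 -> speed_at_most g t (c t)) ->
  forall t (c' : R), 0 <= c' -> (t1 <= t <= t2 -> c t <= c') ->
  speed_at_most (fun s => g (Num.max t1 (Num.min s t2))) t c'.
Proof.
move=> t12 gc t c' c'0 cc'.
pose m s := Num.max t1 (Num.min s t2).
have mL s s' : `|m s - m s'| <= `|s - s'| := dist_clamp t1 t2 s s'.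
have [tt1|t1t] := ltP t t1.
  move=> e e0; exists (t1 - t) => [|s s']; first by rewrite subr_gt0.
  rewrite !ltr_norml => /andP[_ s1] /andP[_ s'1].
  rewrite !max_l ?subrr ?enorm0 ?mulr_ge0 ?addr_ge0 ?(ltW e0)//;
    rewrite ge_min; apply/orP; left; lra.
have [t2t|tt2] := ltP t2 t.
  move=> e e0; exists (t - t2) => [|s s']; first by rewrite subr_gt0.
  rewrite !ltr_norml => /andP[s1 _] /andP[s'1 _].
  rewrite !min_r ?subrr ?enorm0 ?mulr_ge0 ?addr_ge0 ?(ltW e0)//; lra.
have t12' : t1 <= t <= t2 by rewrite t1t.
have mt : m t = t by rewrite /m min_l// max_r.
move=> e e0; have [r r0 rP] := speed_at_mostW (cc' t12') (gc _ t12') e0.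
exists r => // s s' sr s'r.
have mr u : `|u - t| < r -> `|m u - t| < r.
  by apply: le_lt_trans; rewrite -{1}mt.
apply: le_trans (rP _ _ (mr _ sr) (mr _ s'r)) _.
by rewrite ler_wpM2l ?addr_ge0 ?(ltW e0).
Qed.

End Regularity.

Section Penalized.
Variables (R : realType) (d : nat) (Om : set 'rV[R]_d).
Variables (P : 'rV[R]_d -> 'rV[R]_d) (C Kmin Kmax L : R) (k : R -> 'rV[R]_d -> R).
Hypotheses (POm : projects Om P) (C_gt0 : 0 < C).
Hypothesis prox : forall x a b, nearest (closure Om) x a -> closure Om b ->
  dot (x - a) (b - a) <= C * enorm (x - a) * enorm (b - a) ^+ 2.
Hypotheses (Kmin_gt0 : 0 < Kmin) (L_gt0 : 0 < L).
Hypothesis k_speed : speed_on setT Kmin Kmax L k.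
Implicit Types g : R -> 'rV[R]_d.
Let dist := Defs.edist Om.
Let A := closure Om.

(** The speed vanishes from distance eps on, so this distance is not exceeded. *)
Lemma penalized_stays_close eps g t0 : 0 < eps ->
  (forall t, speed_at_most g t (kpen Om eps k (Num.max 0 t) (g t))) ->
  A (g t0) -> forall t, t0 <= t -> dist (g t) <= eps.
Proof.
move=> eps0 gs At0 t1 t01; rewrite leNgt; apply/negP => far.
pose F t := Num.max (dist (g t)) eps.
have F0 : F t0 = eps by rewrite /F max_r// /dist (distance_closure POm At0) ltW.
have F1 : F t1 = dist (g t1) by rewrite /F max_l// ltW.
have FF x y : F x <= F y + enorm (g x - g y).
  have := ler_norm (dist (g x) - dist (g y)); have := distance_lipschitz POm (g x) (g y).
  rewrite -/dist => h1 h2.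
  have h3 : dist (g y) <= F y by rewrite le_max lexx.
  have h4 : eps <= F y by rewrite le_max lexx orbT.
  have h5 := enorm_ge0 (g x - g y).
  by rewrite ge_max; apply/andP; split; lra.
suff main e : 0 < e -> F t1 - e * t1 <= F t0 - e * t0.
  have d0 : 0 < t1 - t0 + 1 by lra.
  have e0 : 0 < (dist (g t1) - eps) / (2 * (t1 - t0 + 1)).
    by rewrite divr_gt0 ?subr_gt0// mulr_gt0.
  have := main _ e0; rewrite F0 F1; set e := _ / _.
  have : e * (2 * (t1 - t0 + 1)) = dist (g t1) - eps.
    by rewrite /e divfK// gt_eqF// mulr_gt0.
  rewrite -/e in e0; nra.
move=> e0; apply: (@right_nonincreasing R (fun t => F t - e * t)) => // t.
  move=> e1 /andP[t0t _] e10.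
  have [r r0 rP] := speed_at_most_continuous (gs t) e10.
  exists r => // s _ rs st; have := FF t s; rewrite enorm_distC.
  have /rP : `|s - t| < r by rewrite distrC ger0_norm ?subr_ge0//; lra.
  have : e * s <= e * t by rewrite ler_wpM2l// ltW.
  lra.
move=> /andP[t0t _]; have [near_|far_] := ltP (dist (g t)) eps.
  have e'0 : 0 < eps - dist (g t) by rewrite subr_gt0.
  have [r r0 rP] := speed_at_most_continuous (gs t) e'0.
  exists r => // s ts sr.
  have /rP h1 : `|s - t| < r by rewrite gtr0_norm ?subr_gt0//; lra.
  have h2 : dist (g s) < eps.
    have := distance_lipschitz POm (g s) (g t); have := ler_norm (dist (g s) - dist (g t)).
    rewrite -/dist; lra.
  rewrite /F max_r ?(ltW h2)// max_r ?(ltW near_)//.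
  have : e * t <= e * s by rewrite ler_pM2l// ltW.
  lra.
have k0 : kpen Om eps k (Num.max 0 t) (g t) = 0.
  have h : 1 - eps^-1 * Defs.edist Om (g t) <= 0.
    by rewrite subr_le0 mulrC ler_pdivlMr// mul1r.
  by rewrite /kpen (max_l h) mulr0.
have := gs t e e0; rewrite k0 add0r => -[r r0 rP].
exists r => // s ts sr.
have st : `|s - t| < r by rewrite gtr0_norm ?subr_gt0//; lra.
have := rP s t st; rewrite subrr normr0 => /(_ r0).
rewrite gtr0_norm ?subr_gt0//; have := FF s t; lra.
Qed.

(** To first order in the distance, projecting relaxes the allowed speed at the
    relative rate L / Kmin and stretches lengths at the rate 2 C; the rate 1 is
    kept as a margin, and the factor 2 keeps all the corrections below 1/2. *)
Definition penalty_threshold : R := (2 * (L / Kmin + 1 + 2 * C))^-1.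

Lemma penalty_threshold_gt0 : 0 < penalty_threshold.
Proof. by rewrite invr_gt0 mulr_gt0// !addr_gt0// ?divr_gt0// mulr_gt0. Qed.

(** Projecting multiplies speeds by at most 1 / (1 - 2 C dist) and raises the
    admissible speed by at most L dist; both are first order in the distance,
    and beaten by the penalty factor 1 - dist / eps once eps is small. *)
Lemma projected_speed eps g t : 0 < eps < penalty_threshold ->
  (forall t, speed_at_most g t (kpen Om eps k (Num.max 0 t) (g t))) ->
  dist (g t) <= eps ->
  speed_at_most (P \o g) t (k (Num.max 0 t) (P (g t)) * (1 - dist (g t))) /\
  dist (g t) <= 2^-1.
Proof.
move=> /andP[eps0 epsq] gs Deps.
set D := dist (g t) in Deps *; have D0 : 0 <= D := distance_ge0 POm _.
pose Lam := L / Kmin; have Lam0 : 0 < Lam by rewrite divr_gt0.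
pose q := eps^-1; have q0 : 0 < q by rewrite invr_gt0.
have qq : 2 * (Lam + 1 + 2 * C) <= q.
  have Z0 : 0 < 2 * (Lam + 1 + 2 * C) by rewrite mulr_gt0// !addr_gt0// mulr_gt0.
  rewrite /q -[leRHS]mul1r ler_pdivlMr// mulrC -[leRHS](mulVf (lt0r_neq0 Z0)).
  by rewrite ler_wpM2r ?(ltW Z0) ?(ltW epsq).
have qD : q * D <= 1 by rewrite /q mulrC ler_pdivrMr// mul1r.
have CD0 : 0 <= C * D by rewrite mulr_ge0// ltW.
have LD0 : 0 <= Lam * D by rewrite mulr_ge0// ltW.
have qqD : 2 * (Lam + 1 + 2 * C) * D <= q * D by rewrite ler_wpM2r.
have D2 : D <= 2^-1 by lra.
have CD : 2 * C * D <= 2^-1 by lra.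
split=> //.
have [kc kK kL] := k_speed.
set t' := Num.max 0 t; have t'0 : 0 <= t' by rewrite le_max lexx.
set kg := k t' (g t); set kp := k t' (P (g t)).
have /andP[kp_ge _] : Kmin <= kp <= Kmax by exact: kK.
have /andP[kg_ge _] : Kmin <= kg <= Kmax by exact: kK.
have kp0 : 0 < kp := lt_le_trans Kmin_gt0 kp_ge.
have kg0 : 0 < kg := lt_le_trans Kmin_gt0 kg_ge.
have D1 : 0 <= 1 - D by lra.
have qD0 : 0 <= 1 - q * D by rewrite subr_ge0.
have kgp : kg <= kp * (1 + Lam * D).
  have := kL t' (g t) (P (g t)) t'0 I I.
  have [_ <-] := POm (g t); rewrite -/dist -/D => h.
  have h1 : kg - kp <= L * D by apply: le_trans (ler_norm _) h.
  have : Kmin * (Lam * D) <= kp * (Lam * D) by rewrite ler_wpM2r.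
  rewrite mulrA mulrCA divff ?gt_eqF// mulr1; lra.
set m := kp * (1 - D).
have m0 : 0 <= m by rewrite mulr_ge0// ltW.
have cE : kpen Om eps k t' (g t) = kg * (1 - q * D).
  by rewrite /kpen -/dist -/D -/q (max_r qD0).
have cm : kg * (1 - q * D) <= m * (1 - 2 * C * D).
  apply: (@le_trans _ _ (kp * (1 + Lam * D) * (1 - q * D))).
    by rewrite ler_wpM2r.
  rewrite -(mulrA kp) -(mulrA kp) ler_wpM2l ?(ltW kp0)//.
  have h1 : 0 <= Lam * D * (q * D) := mulr_ge0 LD0 (mulr_ge0 (ltW q0) D0).
  have h2 : 0 <= D * (C * D) by rewrite mulr_ge0.
  lra.
move=> e e0.
have me : 0 < m + e by lra.
(* then e' + 2 C e' (m + e) = e / 2 <= e (1 - 2 C D), which key will use *)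
pose W := 1 + 2 * C * (m + e).
have W0 : 0 < W by rewrite addr_gt0// !mulr_gt0.
pose e' := e / (2 * W).
have e'0 : 0 < e' by rewrite divr_gt0// mulr_gt0.
have e'E : e' * W = e / 2.
  by rewrite /e' invfM mulrA divfK ?gt_eqF.
have [r r0 rP] := gs t e' e'0; rewrite -/t' cE in rP.
have [r' r'0 r'P] := speed_at_most_continuous (gs t) e'0.
exists (Num.min r r') => [|s s']; first by rewrite lt_min r0.
rewrite !lt_min => /andP[sr sr'] /andP[s'r s'r'].
have ds u : `|u - t| < r' -> dist (g u) <= D + e'.
  move=> /r'P; have := distance_lipschitz POm (g u) (g t); rewrite -/dist -/D.
  have := ler_norm (dist (g u) - D); lra.
have ds1 := ds s sr'; have ds2 := ds s' s'r'.
have [n1 d1] := POm (g s); have [n2 d2] := POm (g s').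
have := nearest_lipschitz prox n1 n2; rewrite -d1 -d2 -/dist => hN.
set N := enorm _ in hN *; have N0 : 0 <= N by exact: enorm_ge0.
have hg := rP s s' sr s'r.
set X := `|s - s'| in hg *; have X0 : 0 <= X by exact: normr_ge0.
pose rho := 1 - 2 * C * (D + e').
have key : kg * (1 - q * D) + e' <= (m + e) * rho.
  have : e * (2 * C * D) <= e * 2^-1 by rewrite ler_wpM2l// ltW.
  move: e'E; rewrite /rho /W; lra.
have c0 : 0 <= kg * (1 - q * D) by rewrite mulr_ge0 ?(ltW kg0).
have rho0 : 0 < rho by rewrite -(pmulr_rgt0 _ me); lra.
rewrite -(ler_pM2l rho0).
have h1 : rho * N <= (1 - C * (dist (g s) + dist (g s'))) * N.
  rewrite ler_wpM2r// /rho lerD2l lerN2 -mulrA mulrCA ler_wpM2l ?(ltW C_gt0)//; lra.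
have h2 := ler_wpM2r X0 key.
apply: le_trans h1 _; apply: le_trans hN _; apply: le_trans hg _.
apply: le_trans h2 _; rewrite le_eqVlt; apply/orP; left; apply/eqP; ring.
Qed.

(** The projection of g, frozen before t0 and after arrival, is the curve h if g
    stays in the closure. Otherwise the projection is slower than allowed while g
    is outside, and h exploits this deficit. *)
Lemma penalized_improved eps g t0 T : 0 < eps < penalty_threshold ->
  Adm setT (kpen Om eps k) g -> 0 <= t0 -> 0 <= T -> A (g t0) -> A (g (T + t0)) ->
  exists h T', [/\ Adm A k h, h t0 = g t0, h (T' + t0) = g (T + t0), 0 <= T' <= T &
    (exists2 t, t0 <= t <= t0 + T & ~ A (g t)) -> T' < T].
Proof.
move=> eps_small Ag t00 T0 At0 AT; have /andP[eps0 _] := eps_small.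
pose t2 := t0 + T; have t02 : t0 <= t2 by rewrite lerDl.
pose gam s := g (Num.max t0 (Num.min s t2)).
have gamE t : t0 <= t <= t2 -> gam t = g t.
  by move=> /andP[tt tt2]; rewrite /gam min_l// max_r.
have gam_le t : t <= t0 -> gam t = g t0.
  by move=> tt; rewrite /gam max_l// ge_min tt.
have gam_ge t : t2 <= t -> gam t = g t2.
  by move=> tt; rewrite /gam min_r// max_r.
have gs t : speed_at_most gam t (kpen Om eps k (Num.max 0 t) (gam t)).
  have h := @speed_clamp R d (fun s => g (Num.max 0 s))
    (fun t => kpen Om eps k t (g t)) t0 t2 t02.
  have -> : gam = (fun s => g (Num.max 0 (Num.max t0 (Num.min s t2)))).
    apply/funext => s; rewrite /gam; congr g; apply/esym/max0_le.
    by rewrite le_max t00.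
  apply: h.
  - move=> u /andP[tu _]; apply: Adm_kpen_speed k_speed Ag _ _ => //.
    exact: le_trans tu.
  - by apply: kpen_ge0 k_speed _ => //; rewrite le_max lexx.
  - move=> /andP[tt tt2]; rewrite (max0_le t).2; last exact: le_trans tt.
    by rewrite (min_l tt2) (max_r tt) (max0_le t).2//; exact: le_trans tt.
have A_gam0 : A (gam t0) by rewrite gam_le.
have near_ t : dist (gam t) <= eps.
  have [tt|/ltW tt] := leP t0 t.
    exact: (penalized_stays_close eps0 gs A_gam0 tt).
  by rewrite (gam_le t tt) /dist (distance_closure POm At0); exact: ltW.
pose eta := P \o gam.
have etaS t := projected_speed eps_small gs (near_ t).
have etaA t : A (eta t) by have [[]] := POm (gam t).
have eta0 : eta t0 = g t0 by rewrite /eta /= (proj_closure POm A_gam0) gam_le.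
have A2 : A (g t2) by move: AT; rewrite addrC.
have eta2 : eta t2 = g (T + t0).
  by rewrite /eta /= gam_ge// (proj_closure POm A2) addrC.
have [_ kK kL] := k_speed.
have kE t : Kmin <= k (Num.max 0 t) (eta t) by
  have /andP[] := kK (Num.max 0 t) (eta t) (ltac:(rewrite le_max lexx //)) I.
have Kle t : k (Num.max 0 t) (eta t) * (1 - dist (gam t)) <= k (Num.max 0 t) (eta t).
  rewrite ler_piMr//; first exact: le_trans (ltW Kmin_gt0) (kE t).
  by rewrite lerBlDr lerDl; exact: distance_ge0 POm _.
have [[t1 t01 nA]|allA] := pselect (exists2 t, t0 <= t <= t2 & ~ A (g t)); last first.
  exists eta, T; split => //.
  - apply: (speed_on_Adm Kmin_gt0 k_speed) => // t; apply: speed_at_mostW (Kle t) _.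
    by have [] := etaS t.
  - by rewrite -eta2 /t2 addrC.
  - by rewrite T0 lexx.
have gam_c := speed_continuous gs.
have eta_c : continuous eta.
  by apply: (@speed_continuous _ _ eta) => t; have [h _] := etaS t; exact: h.
have [D [DE D_c D_half D1]] : exists D : R -> R,
    [/\ forall t, D t = dist (gam t), continuous D, forall t, D t <= 2^-1 & 0 < D t1].
  exists (fun t => dist (gam t)); split.
  - by move=> t.
  - exact: (distance_curve_continuous POm gam_c).
  - by move=> t; have [_ h] := etaS t; exact: h.
  - rewrite lt_neqAle (distance_ge0 POm) andbT eq_sym; apply/eqP => D0; apply: nA.
    by rewrite -(gamE t1 t01); exact: (distance_eq0 POm D0).
pose K t := k (Num.max 0 t) (eta t) * (1 - D t).
have etaK t : speed_at_most eta t (K t).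
  by rewrite /K DE; have [] := etaS t.
have KleD t : K t <= k (Num.max 0 t) (eta t) by rewrite /K DE; exact: Kle.
have t12 : t1 < t2.
  rewrite lt_neqAle; case/andP: (t01) => _ ->; rewrite andbT.
  by apply/eqP => t1E; apply: nA; rewrite t1E.
clear nA.
(* the projection is slow on an interval [t1, b] on which gam is outside *)
have [r r0 rP] : exists2 r, 0 < r & forall s, `|s - t1| < r -> D t1 / 2 <= D s.
  have D2 : 0 < D t1 / 2 by lra.
  have /cvgrPdist_lt/(_ _ D2)/nbhs_ballP[r /= r0 rP] := D_c t1.
  exists r => // s st; have /rP : ball t1 r s by rewrite /ball/= distrC.
  by rewrite /= ltr_norml => /andP[]; lra.
pose b := Num.min (t1 + r / 2) t2.
have t1b : t1 < b by rewrite lt_min t12 andbT; lra.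
have bt2 : b <= t2 by rewrite ge_min lexx orbT.
have br : b <= t1 + r / 2 by rewrite ge_min lexx.
have D12 : 0 < D t1 / 2 by lra.
have sig0 : 0 < Kmin * (D t1 / 2) := mulr_gt0 Kmin_gt0 D12.
have K00 : 0 < Kmin / 2 := divr_gt0 Kmin_gt0 (ltr0Sn R 1).
have K_c : continuous K.
  move=> t; apply: cvgM; first exact: (speed_on_continuous k_speed eta_c (x := t)).
  by apply: (@cvgB _ _ _ (nbhs t)); [exact: cvg_cst|exact: D_c].
have K0le t : Kmin / 2 <= K t.
  have h := D_half t; have kEt := kE t; rewrite /K.
  by apply: ler_pM; [exact: ltW|rewrite invr_ge0|exact: kEt|lra].
have slack t : t1 <= t <= b -> K t + Kmin * (D t1 / 2) <= k (Num.max 0 t) (eta t).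
  move=> /andP[tt1 tb]; have h : D t1 / 2 <= D t.
    by apply: rP; rewrite ger0_norm ?subr_ge0//; lra.
  have : Kmin * (D t1 / 2) <= k (Num.max 0 t) (eta t) * D t.
    by apply: ler_pM; [exact: ltW|exact: ltW|exact: kE|exact: h].
  rewrite /K; lra.
have kL' t x y : `|k (Num.max 0 t) x - k (Num.max 0 t) y| <= L * enorm (x - y).
  by apply: kL => //; rewrite le_max lexx.
have [zeta [zR z0 [t' /andP[t't tt'] zt'] zs]] :=
  faster_curve K_c K00 K0le etaK KleD sig0 slack L_gt0 kL' t1b bt2.
exists zeta, (t' - t0); split.
- by apply: (speed_on_Adm Kmin_gt0 k_speed) => // t; have [s ->] := zR t.
- by rewrite z0//; case/andP: t01.
- by rewrite subrK zt' eta2.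
- case/andP: t01 => t01 _; apply/andP; split; first by lra.
  by move: tt'; rewrite /t2; lra.
- by move=> _; move: tt'; rewrite /t2; lra.
Qed.

End Penalized.

(** * Arrival times and values *)

Section Values.
Variables (R : realType) (d : nat).
Implicit Types (X Gam : set 'rV[R]_d) (g : R -> 'rV[R]_d) (k : R -> 'rV[R]_d -> R).

Lemma Adm_congr X X' k k' g : (forall t, 0 <= t -> X' (g t)) ->
  (forall t, 0 <= t -> k t (g t) = k' t (g t)) -> Adm X k g -> Adm X' k' g.
Proof.
move=> gX' kk' [gL _ [u [mu u1 gu]]]; split => //; exists u; split => //.
apply: filterS gu; first exact: (ae_filter_ringOfSetsType lebesgue_measure).
by move=> t gt t0; rewrite -kk'//; exact: gt.
Qed.

Lemma value_le X X' k k' Gam t0 x :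
  (forall g, Adm X k g -> Adm X' k' g) ->
  (value X' k' Gam t0 x <= value X k Gam t0 x)%E.
Proof.
move=> incl; apply/ereal_infP => _ [g [Ag gx] <-].
by apply: ereal_inf_lbound; exists g => //; split => //; exact: incl.
Qed.

Lemma hitting_time_le Gam g (t0 T : R) : 0 <= T -> Gam (g (T + t0)) ->
  (hitting_time Gam t0 g <= T%:E)%E.
Proof. by move=> T0 gT; apply: ereal_inf_lbound; exists T. Qed.

Lemma hitting_time_attained Gam g (t0 : R) : closed Gam ->
  [lipschitz g t | t in [set t : R | 0 <= t]] -> 0 <= t0 ->
  (hitting_time Gam t0 g < +oo)%E ->
  exists T, [/\ 0 <= T, Gam (g (T + t0)) & hitting_time Gam t0 g = T%:E].
Proof.
move=> cG /lipschitz_onP[K K0 gK] t00 fin.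
pose S := [set t : R | 0 <= t /\ Gam (g (t + t0))].
have S0 : S !=set0.
  by have [z [t St _] _] := ereal_inf_lt fin; exists t.
have Slb : has_lbound S by exists 0 => t [].
have Tlb t : S t -> inf S <= t by exact: ge_inf.
have T0 : 0 <= inf S by apply: lb_le_inf => // t [].
exists (inf S); split => //; last by rewrite /hitting_time ereal_inf_EFin.
apply: cG => N NT.
have /nbhs_ballP[e /= e0 eN] := NT.
have eK : 0 < e / K by rewrite divr_gt0.
have [t St] := inf_adherent eK (conj S0 Slb).
rewrite -ltrBlDl => tT; exists (g (t + t0)); have [t'0 Gt] := St; split => //.
apply: eN; rewrite -ball_normE /=; apply: le_lt_trans (norm_le_enorm _) _.
apply: le_lt_trans (gK _ _ _ _) _; rewrite ?addr_ge0//.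
rewrite opprD addrACA subrr addr0 distrC ger0_norm ?subr_ge0 ?Tlb//.
by rewrite mulrC -ltr_pdivlMr.
Qed.

(** A path from x to the target, run at the speed Kmin, is admissible. This
    matters because a value +oo would make optimal every curve that never
    arrives. *)
Lemma joined_value_finite X Gam (Kmin Kmax L t0 : R) k x y : 0 < Kmin ->
  speed_on setT Kmin Kmax L k -> joined X x y -> 0 <= t0 -> Gam y ->
  (value X k Gam t0 x < +oo)%E.
Proof.
move=> Kmin0 ks [c [K [c0 c1 cX cK]]] t00 Gy.
pose v := Kmin / (`|K| + 1).
have K1 : 0 < `|K| + 1 by rewrite ltr_wpDl.
have v0 : 0 < v by rewrite divr_gt0.
pose m t := Num.max 0 (Num.min (v * (t - t0)) 1).
have m01 t : 0 <= m t <= 1 by rewrite le_max lexx/= ge_max ler01 ge_min lexx orbT.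
have mL s s' : `|m s - m s'| <= v * `|s - s'|.
  apply: le_trans (dist_clamp _ _ _ _) _.
  by rewrite -mulrBr normrM gtr0_norm// opprB addrA subrK.
have hL s s' : enorm (c (m s) - c (m s')) <= Kmin * `|s - s'|.
  apply: le_trans (cK _ _ (m01 s) (m01 s')) _.
  apply: (@le_trans _ _ ((`|K| + 1) * (v * `|s - s'|))).
    apply: (@le_trans _ _ (`|K| * `|m s - m s'|)).
      by rewrite ler_wpM2r// ler_norm.
    by apply: ler_pM => //; lra.
  by rewrite mulrA /v mulrCA divff ?mulr1// gt_eqF.
have Ac : Adm X k (fun t => c (m t)).
  apply: (speed_on_Adm Kmin0 ks) => [t|t]; last exact: cX.
  have [_ kK _] := ks; apply: (@speed_at_mostW _ _ _ _ Kmin).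
    by have /andP[] := kK (Num.max 0 t) (c (m t)) (ltac:(rewrite le_max lexx //)) I.
  move=> e e0; exists 1 => // s s' _ _; apply: le_trans (hL s s') _.
  by rewrite ler_wpM2r// lerDl ltW.
apply: le_lt_trans (ltry (v^-1)).
apply: le_trans (@hitting_time_le Gam (fun t => c (m t)) t0 v^-1 _ _); last 2 first.
- by rewrite invr_ge0 ltW.
- by rewrite /m addrK divff ?gt_eqF// minxx max_r// c1.
apply: ereal_inf_lbound; exists (fun t => c (m t)) => //; split => //.
by rewrite /m subrr mulr0 min_l// max_l.
Qed.

End Values.

(** * Comparison of the two problems *)

Theorem theorem4p8 (R : realType) (d : nat) (d_gt0 : (0 < d)%N)
    (Omega Gam : set 'rV[R]_d)
    (Omega_neq0 : Omega !=set0) (Omega_open : open Omega)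
    (Omega_bounded : bounded_set Omega) (Omega_connected : connected Omega)
    (bdry_compact : compact (bdry Omega))
    (bdry_C11 : C11_submanifold d.-1 (bdry Omega))
    (Gam_sub : Gam `<=` closure Omega) (Gam_neq0 : Gam !=set0)
    (Gam_closed : closed Gam)
    (Kmin Kmax L : R) (Kmin_gt0 : 0 < Kmin) (Kmax_gt0 : 0 < Kmax) (L_gt0 : 0 < L)
    (k : R -> 'rV[R]_d -> R)
    (k_speed : speed_on (closure Omega) Kmin Kmax L k)
    (kext : R -> 'rV[R]_d -> R)
    (kext_speed : speed_on setT Kmin Kmax L kext)
    (kext_k : forall t x, 0 <= t -> closure Omega x -> kext t x = k t x) :
  exists2 eps0 : R, 0 < eps0 &
    forall (eps t0 : R) (x0 : 'rV[R]_d),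
      0 < eps < eps0 -> 0 <= t0 -> closure Omega x0 ->
      Opt_eps Gam (kpen Omega eps kext) t0 x0 = Opt Omega Gam k t0 x0 /\
      OCP_value_eps Gam (kpen Omega eps kext) t0 x0 = OCP_value Omega Gam k t0 x0.
Proof.
set A := closure Omega.
have Abnd := C11_domain_tangent_path d_gt0 Omega_open bdry_C11.
have [P POm] := nearest_exists Omega_neq0 Omega_bounded.
have [C C_gt0 prox] := proximal_uniform (closure_compact Omega_bounded) Abnd.
exists (penalty_threshold C Kmin L); first exact: penalty_threshold_gt0.
move=> eps t0 x0 eps_small t00 Ax0.
pose keps := kpen Omega eps kext.
have keps_k t x : 0 <= t -> A x -> keps t x = k t x.
  move=> t_ge0 Ax; rewrite /keps /kpen (distance_closure POm Ax) mulr0 subr0.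
  by rewrite max_r ?ler01// mulr1 kext_k.
have Adm_incl g : Adm A k g -> Adm setT keps g.
  move=> Ag; have [_ gA _] := Ag; apply: Adm_congr Ag => // t t_ge0.
  by rewrite keps_k//; exact: gA.
have Adm_conv g : Adm setT keps g -> (forall t, 0 <= t -> A (g t)) -> Adm A k g.
  move=> Ag gA; apply: Adm_congr Ag => // t t_ge0.
  by rewrite keps_k//; exact: gA.
have improve g T : Adm setT keps g -> g t0 = x0 -> 0 <= T -> Gam (g (T + t0)) ->
    exists h T', [/\ Adm A k h, h t0 = x0, Gam (h (T' + t0)), 0 <= T' <= T &
      (exists2 t, t0 <= t <= t0 + T & ~ A (g t)) -> T' < T].
  move=> Ag gx0 T0 GT.
  have [||h [T' [Ah h0 hT' T'T strict]]] :=
    penalized_improved POm C_gt0 prox Kmin_gt0 L_gt0 kext_speed eps_small Ag t00 T0 _ _.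
  - by rewrite gx0.
  - exact: Gam_sub.
  exists h, T'; split; [|by rewrite h0|by rewrite hT'|exact: T'T|exact: strict].
  have [_ hA _] := Ah; apply: Adm_congr Ah => // t t_ge0.
  by rewrite kext_k//; exact: hA.
have value_eq : value setT keps Gam t0 x0 = value A k Gam t0 x0.
  apply/eqP; rewrite eq_le; apply/andP; split; first exact: value_le Adm_incl.
  apply/ereal_infP => _ [g [Ag gx0] <-].
  have [fin|] := ltP (hitting_time Gam t0 g) +oo%E; last first.
    by rewrite leye_eq => /eqP ->; exact: leey.
  have [gL _ _] := Ag.
  have [T [T0 GT ->]] := hitting_time_attained Gam_closed gL t00 fin.
  have [h [T' [Ah h0 GT' /andP[T'0 T'T] _]]] := improve g T Ag gx0 T0 GT.
  apply: (@le_trans _ _ T'%:E); last by rewrite lee_fin.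
  apply: le_trans (hitting_time_le T'0 GT').
  by apply: ereal_inf_lbound; exists h.
have value_fin : (value A k Gam t0 x0 < +oo)%E.
  have [y Gy] := Gam_neq0.
  have x0y := C11_domain_joined d_gt0 Omega_open Omega_connected bdry_C11 Ax0
    (Gam_sub _ Gy).
  apply: le_lt_trans (joined_value_finite Kmin_gt0 kext_speed x0y t00 Gy).
  apply: value_le => g Ag; have [_ gA _] := Ag; apply: Adm_congr Ag => // t t_ge0.
  by rewrite kext_k//; exact: gA.
split; last exact: value_eq.
apply/seteqP; split => g.
- move=> [[Ag g0 gT gend] fin].
  have gx0 : g t0 = x0 by apply: g0; rewrite t00 lexx.
  have [gL _ _] := Ag.
  have hfin : (hitting_time Gam t0 g < +oo)%E by rewrite gT.
  have [T [T0 GT TE]] := hitting_time_attained Gam_closed gL t00 hfin.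
  have gA t : 0 <= t -> A (g t).
    move=> t_ge0; have [tt0|/ltW t0t] := leP t t0.
      by rewrite g0 ?t_ge0.
    have inside u : t0 <= u <= t0 + T -> A (g u).
      move=> tu; apply: contrapT => nA.
      have [h [T' [Ah h0 GT' /andP[T'0 T'T] strict]]] := improve g T Ag gx0 T0 GT.
      have := strict (ex_intro2 _ _ u tu nA); apply/negP; rewrite -leNgt.
      rewrite -lee_fin -TE gT value_eq; apply: le_trans (hitting_time_le T'0 GT').
      by apply: ereal_inf_lbound; exists h.
    have [tT|/ltW tT] := leP t (t0 + T); first by apply: inside; rewrite t0t.
    rewrite gend ?TE -?EFinD ?lee_fin//=; apply: inside.
    by rewrite lerDl T0 lexx.
  by split => //; [exact: Adm_conv|rewrite gT value_eq].
- move=> [Ag g0 gT gend]; split; last by rewrite /= /OCP_value_eps value_eq.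
  by split => //; [exact: Adm_incl|rewrite gT value_eq].
Qed.
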